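(* Let $\Omega$ be a measurable space, $f:\Omega\to\mathbb{R}^+$ a measurable function, and $(X_n)_{n\geq0}$ a measurable Markov chain on $\Omega$. Assume there exist a sublevel set $K=\{f\leq R_0\}$ and integrable real random variables $Z_0,Z_1$ with $\mathbb{E}[Z_1]=-\lambda_1<0$ such that 1. for every $x\in K$ and $t\in\mathbb{R}$, $\mathbb{P}_x(f(X_1)-f(x)>t)\leq\mathbb{P}(Z_0>t)$; 2. for every $x\in\Omega\smallsetminus K$ and $t\in\mathbb{R}$, $\mathbb{P}_x(f(X_1)-f(x)>t)\leq\mathbb{P}(Z_1>t)$. Then for all $\varepsilon>0$, there exists $R>0$ such that for all $x\in\Omega$: (i) for all $n\geq1$, $\displaystyle\mathbb{P}_x[f(X_n)>R]<\varepsilon+\frac{f(x)}{n\lambda_1}$; (ii) $\mathbb{P}_x$-almost surely, $$\limsup_{n\to+\infty}\frac1n\,\mathrm{card}\{k\in\{1,\dots,n\}\ :\ f(X_k)>R\}<\varepsilon.$$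
   Context: $\mathbb{R}^+=[0,+\infty)$. The Markov chain is time-homogeneous with a measurable transition kernel on $\Omega$; $\mathbb{P}_x$ denotes its law conditional on $X_0=x$. *)

(* Defs.v *)
From HB Require Import structures.
From mathcomp Require Import all_boot all_order all_algebra.
From mathcomp Require Import all_classical all_reals all_analysis.

Set Implicit Arguments.
Unset Strict Implicit.
Unset Printing Implicit Defensive.
Import Order.TTheory GRing.Theory Num.Theory.
Local Open Scope classical_set_scope.
Local Open Scope ring_scope.

Definition process_history (dW dS : measure_display) (W : measurableType dW)
    (S : measurableType dS) (X : nat -> {mfun W >-> S}) (n : nat) :
    set (set W) :=
  <<s [set E | exists k (B : set S),
         [/\ (k <= n)%N, measurable B & E = X k @^-1` B]] >>.

(* [P x] is the law conditional on X_0 = x.  The initial condition is stated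
   as "X_0 has law delta_x", since singletons need not be measurable; the
   transition clause is P_x(X_{n+1} in B | X_0, ..., X_n) = kappa (X_n, B) a.s.,
   with the conditional probability unfolded to its defining integral identity
   over the events of sigma(X_0, ..., X_n). *)
Definition is_markov_chain (dW dS : measure_display) (W : measurableType dW)
    (S : measurableType dS) (R : realType) (kappa : R.-pker S ~> S)
    (P : S -> probability W R) (X : nat -> {mfun W >-> S}) : Prop :=
  forall x : S,
    (forall B : set S, measurable B -> P x (X 0%N @^-1` B) = \d_x B) /\
    (forall (n : nat) (E : set W) (B : set S),
       process_history X n E -> measurable B ->
       P x (E `&` X n.+1 @^-1` B) = (\int[P x]_(w in E) kappa (X n w) B)%E).

(* Main.v *)
(* Write S for the up-set of reals lying above some value of [f] outside [K]; then
   [f x] is in S exactly when [x] is outside [K], and the jumps [Z1] almost surely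
   do not send a point of S below 0.  Stochastic domination bounds every excursion
   of [f (X n)] outside [K] by the [Z1]-walk killed when it leaves S, started from
   [R0 + Z0].  By Foster's argument this walk started at [s] survives [n] steps
   with probability at most [s / (n * lambda1)], and the expected length of an
   excursion from [K] is finite; hence the expected time [b r] that an excursion
   spends above [r] tends to 0 as [r] grows.

   (i) Decomposing at the last visit to [K] before time [n] gives
   [P_x (f (X n) > r) <= P (the walk from f x survives n steps) + b r].

   (ii) Keep a budget in nat: a visit to [K] earns 1, a visit to [f > r] costs [q],
   truncated at 0.  Let [Psi c] be the worst expected number, over starting points
   in [K], of visits to [K] with an empty budget.  Decomposing at the first return
   to [K] and summing over all budgets [c], a telescoping sum leaves
   [Psi 0 <= 1 + q * b r * Psi 0], so [Psi 0 <= 2] once [q * b r <= 1 / 2].  Hence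
   almost surely the truncation acts finitely often, and the number of visits to
   [f > r] before time [n] is at most [(n + O(1)) / q]. *)

Require Import Defs.
From HB Require Import structures.
From mathcomp Require Import all_boot all_order all_algebra.
From mathcomp Require Import all_classical all_reals all_analysis.
From mathcomp Require Import measurable_realfun ring lra zify.
Import Order.TTheory GRing.Theory Num.Theory.
Local Open Scope classical_set_scope.
Local Open Scope ring_scope.

Set Implicit Arguments.
Unset Strict Implicit.

(** * Stochastic domination *)

Lemma measurable_gt (d : measure_display) (T : measurableType d) (R : realType)
    (Y : {mfun T >-> R}) (t : R) : measurable [set w | t < Y w].
Proof.
rewrite (_ : [set w | _] = Y @^-1` `]t, +oo[); last first.
  by apply/seteqP; split => w /=; rewrite in_itv/= andbT.
by rewrite -[X in measurable X]setTI; exact: measurable_funP.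
Qed.

(** The domination hypotheses control open tails; a closed tail is a decreasing limit of them. *)
Lemma closed_tail_cvg (d : measure_display) (T : measurableType d)
    (R : realType) (P : probability T R) (Y : {mfun T >-> R}) (m : R) :
  P [set w | m - n.+1%:R^-1 < Y w] @[n --> \oo] --> P [set w | m <= Y w].
Proof.
rewrite (_ : [set w | m <= Y w] =
    \bigcap_n [set w | m - n.+1%:R^-1 < Y w]); last first.
  apply/seteqP; split => [w /= mY n _ /=|w /= h].
    by rewrite (lt_le_trans _ mY)// ltrBlDr ltrDl invr_gt0.
  rewrite leNgt; apply/negP => Ym.
  (* With [n] the integer part of [(m - Y w)^-1], [1/(n+1) < m - Y w], against membership in the
     [n]-th set. *)
  have := h (Num.truncn (m - Y w)^-1) I; rewrite /= ltrBlDr -ltrBlDl ltNge.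
  move=> /negP; apply.
  rewrite -[leRHS]invrK lef_pV2 ?posrE ?invr_gt0 ?subr_gt0//.
  by rewrite ltW// truncnS_gt.
apply: nonincreasing_cvg_mu => //.
- by rewrite (le_lt_trans (probability_le1 _ (measurable_gt _ _)))// ltry.
- by move=> n; exact: measurable_gt.
- by apply: bigcap_measurable => // n _; exact: measurable_gt.
- move=> i j ij; apply/subsetPset => w /=; apply: le_lt_trans.
  by rewrite lerB// lef_pV2 ?posrE// ler_nat.
Qed.

Section stochastic_domination.
Context (d1 d2 : measure_display) (T1 : measurableType d1)
  (T2 : measurableType d2) (R : realType)
  (P1 : probability T1 R) (P2 : probability T2 R)
  (Y1 : {mfun T1 >-> R}) (Y2 : {mfun T2 >-> R}).
Hypothesis tail_le : forall t : R,
  (P1 [set w | (t < Y1 w)%R] <= P2 [set w | (t < Y2 w)%R])%E.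

(** An up-set of reals is empty, the whole line, or a half-line from its infimum. The open half-line
    is the hypothesis; the closed one follows by a limit. *)
Lemma le_prob_upset (A : set R) : (forall s t : R, s <= t -> A s -> A t) ->
  (P1 (Y1 @^-1` A) <= P2 (Y2 @^-1` A))%E.
Proof.
move=> upA.
have [->|/set0P A0] := eqVneq A set0; first by rewrite !preimage_set0 !measure0.
have [lbA|nlbA] := pselect (has_lbound A); last first.
  suff -> : A = setT by rewrite !preimage_setT !probability_setT.
  apply/seteqP; split => // s _; apply: contrapT => As; apply: nlbA.
  exists s => t At; rewrite leNgt; apply/negP => ts; apply: As.
  exact: upA (ltW ts) At.
set m := inf A.
have gtA s : m < s -> A s.
  move=> ms; have [t At ts] := inf_lt A0 ms.
  exact: upA (ltW ts) At.
have geA s : A s -> m <= s by exact: ge_inf.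
have [Am|Am] := pselect (A m).
- have E T (Y : T -> R) : Y @^-1` A = [set w | m <= Y w].
    by apply/seteqP; split => [w|w /= mY]; [exact: geA|exact: upA mY Am].
  rewrite !E; have c1 := closed_tail_cvg (P := P1) (Y := Y1) (m := m).
  have c2 := closed_tail_cvg (P := P2) (Y := Y2) (m := m).
  rewrite -(cvg_lim _ c1)// -(cvg_lim _ c2)//; apply: lee_lim.
  + by apply/cvg_ex; eexists; exact: c1.
  + by apply/cvg_ex; eexists; exact: c2.
  + by apply: nearW => n; exact: tail_le.
- have E T (Y : T -> R) : Y @^-1` A = [set w | m < Y w].
    apply/seteqP; split => [w /= Aw|w /= mY]; last exact: gtA.
    rewrite lt_neqAle geA// andbT; apply: contra_notN Am => /eqP ->//.
  by rewrite !E.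
Qed.

End stochastic_domination.

(** The preimage of an upper ray under a nondecreasing function is an interval. *)
Lemma homo_measurable (R : realType) (h : R -> \bar R) :
  {homo h : s t / (s <= t)%R >-> (s <= t)%E} -> measurable_fun setT h.
Proof.
move=> hm; apply: (measurability _ (ErealGenOInfty.measurableE R)) => //.
move=> _ [_ [r ->] <-]; apply: measurableI => //.
apply: is_interval_measurable => s t /=.
rewrite !in_itv/= !andbT => hs ht u /andP[su _].
by rewrite in_itv/= andbT (lt_le_trans hs)// hm.
Qed.

(** Layer-cake formula: both integrals are integrals over levels [r] of the probability of the
    up-set where [h] exceeds [r]. The bound [C] makes [h] real-valued. *)
Lemma le_integral_stoch_dom (d1 d2 : measure_display) (T1 : measurableType d1)
    (T2 : measurableType d2) (R : realType)
    (P1 : probability T1 R) (P2 : probability T2 R)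
    (Y1 : {mfun T1 >-> R}) (Y2 : {mfun T2 >-> R}) (h : R -> \bar R) (C : R) :
  (forall t : R,
    (P1 [set w | (t < Y1 w)%R] <= P2 [set w | (t < Y2 w)%R])%E) ->
  (forall s, 0 <= h s)%E -> (forall s, h s <= C%:E)%E ->
  {homo h : s t / (s <= t)%R >-> (s <= t)%E} ->
  (\int[P1]_w h (Y1 w) <= \int[P2]_w h (Y2 w))%E.
Proof.
move=> dom h0 hC hm.
have hfin s : h s \is a fin_num.
  by rewrite ge0_fin_numE// (le_lt_trans (hC s))// ltry.
have mh : measurable_fun setT (fine \o h).
  by apply: measurableT_comp => //; exact: homo_measurable.
have layer d (T : measurableType d) (P : probability T R) (Y : {mfun T >-> R}) :
    (\int[P]_w h (Y w) =
     \int[lebesgue_measure]_(r in `[0%R, +oo[)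
       P (Y @^-1` [set s | r%:E < h s]))%E.
  have mhY : measurable_fun setT (fun w => fine (h (Y w))).
    exact: (measurableT_comp mh).
  pose Z : {mfun T >-> R} := HB.pack (fun w => fine (h (Y w)))
    (isMeasurableFun.Build _ _ _ _ (fun w => fine (h (Y w))) mhY).
  transitivity ('E_P[Z])%E.
    by rewrite unlock; apply: eq_integral => w _; rewrite /= fineK.
  rewrite ge0_expectation_ccdf//; last by move=> w; exact: fine_ge0.
  apply: eq_integral => r _; rewrite /ccdf /distribution /pushforward/=.
  congr (P _); apply/seteqP; split => w /=; rewrite in_itv/= andbT.
    by rewrite -lte_fin fineK.
  by rewrite -[in X in X -> _](fineK (hfin _)) lte_fin.
have mlev d (T : measurableType d) (P : probability T R) (Y : {mfun T >-> R}) :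
    measurable_fun setT (fun r : R => P (Y @^-1` [set s | (r%:E < h s)%E])).
  (* The probability is nonincreasing in the level; reflecting the level makes [homo_measurable]
     applicable. *)
  pose phi (u : R) := P (Y @^-1` [set s | ((- u)%:E < h s)%E]).
  rewrite (_ : (fun r => _) = phi \o -%R); last first.
    by apply/funext => r; rewrite /phi/= opprK.
  apply: measurableT_comp => //; apply: homo_measurable => r t rt.
  have mset u : measurable (Y @^-1` [set s | ((- u)%:E < h s)%E]).
    rewrite -[X in measurable X]setTI; apply: measurable_funP => //.
    rewrite -[X in measurable X]setTI.
    by apply: emeasurable_fun_o_infty => //; exact: homo_measurable hm.
  apply: le_measure; rewrite ?inE//.
  by move=> w /=; apply: le_lt_trans; rewrite lee_fin lerN2.
rewrite !layer; apply: ge0_le_integral => //.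
- by apply: measurable_funTS; exact: mlev.
- by apply: measurable_funTS; exact: mlev.
- move=> r _; apply: le_prob_upset => // s t st /= hs.
  exact: lt_le_trans hs (hm _ _ st).
Qed.

(** * The Markov property *)

Lemma measurable_set_cst (d : measure_display) (T : measurableType d) (A : Prop) :
  measurable [set _ : T | A].
Proof.
have [a|na] := pselect A.
  by rewrite (_ : [set _ | _] = setT)//; apply/seteqP; split.
by rewrite (_ : [set _ | _] = set0)//; apply/seteqP; split.
Qed.

Lemma measurable_fun_select (d : measure_display) (T : measurableType d)
    (R : realType) (F : nat -> T -> \bar R) (s : T -> nat) :
  (forall i, measurable_fun setT (F i)) ->
  (forall i, measurable [set x | s x = i]) ->
  measurable_fun setT (fun x => F (s x) x).
Proof.
move=> mF ms _ B mB; rewrite setTI.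
rewrite (_ : _ @^-1` B = \bigcup_i ([set x | s x = i] `&` F i @^-1` B)).
  apply: bigcup_measurable => i _; apply: measurableI => //.
  by rewrite -[X in measurable X]setTI; exact: mF.
apply/seteqP; split => [x Bx|x [i _ [/= -> //]]].
by exists (s x).
Qed.

(* Expectations of path functionals are reduced to iterated kernel integrals by
   letting an automaton with states in nat read the path. *)
Fixpoint machine_run (T : Type) (st : nat -> T -> nat) (y : nat -> T) (j n : nat) :=
  if n is n'.+1 then st (machine_run st y j n') (y n') else j.

(** [machine_run] recurses on the last letter; the Markov property needs the first letter peeled off
    instead. *)
Lemma machine_runS (T : Type) (st : nat -> T -> nat) (y : nat -> T) j n :
  machine_run st y j n.+1 = machine_run st (fun i => y i.+1) (st j (y 0%N)) n.
Proof. by elim: n => // n IH; rewrite [RHS]/= -IH. Qed.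

Section markov_chain.
Context (R : realType) (dS : measure_display) (Omega : measurableType dS)
  (dW : measure_display) (W : measurableType dW) (kappa : R.-pker Omega ~> Omega)
  (P : Omega -> probability W R) (X : nat -> {mfun W >-> Omega}).
Hypothesis X_markov : is_markov_chain kappa P X.

Lemma process_history_measurable n E : process_history X n E -> measurable E.
Proof.
apply: smallest_sub; first exact: sigma_algebra_measurable.
move=> _ [k [B [_ mB ->]]]; rewrite -[X in measurable X]setTI.
exact: measurable_funP.
Qed.

Lemma process_historyS n E : process_history X n E -> process_history X n.+1 E.
Proof.
apply: sub_sigma_algebra2 => A [k [B [kn mB ->]]]; exists k, B; split => //.
exact: leqW.
Qed.

Lemma process_historyI n E (B : set Omega) : process_history X n E ->
  measurable B -> process_history X n (E `&` X n @^-1` B).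
Proof.
move=> hE mB.
have hB : process_history X n (X n @^-1` B).
  by apply: sub_sigma_algebra; exists n, B; split.
exact: (@measurableI _ (g_sigma_algebraType _) E _ hE hB).
Qed.

Lemma process_historyT n : process_history X n setT.
Proof.
by apply: sub_sigma_algebra; exists n, setT; split; rewrite ?preimage_setT.
Qed.

Import HBNNSimple.

Lemma kernel_measurable (h : Omega -> \bar R) : (forall x, 0 <= h x)%E ->
  measurable_fun setT h -> measurable_fun setT (fun x => \int[kappa x]_y h y)%E.
Proof.
move=> h0 mh; apply: measurable_fun_integral_kernel => //.
by move=> U mU; exact: measurable_kernel.
Qed.

Lemma kernel_ge0 (h : Omega -> \bar R) x : (forall x, 0 <= h x)%E ->
  (0 <= \int[kappa x]_y h y)%E.
Proof. by move=> h0; apply: integral_ge0 => y _. Qed.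

(** A simple function is a finite combination of indicators, and for an indicator the identity is
    the transition clause of [is_markov_chain]. *)
Let markov_nnsfun x n E (h : {nnsfun Omega >-> R}) : process_history X n E ->
  (\int[P x]_(w in E) (h (X n.+1 w))%:E =
   \int[P x]_(w in E) \int[kappa (X n w)]_y (h y)%:E)%E.
Proof.
move=> hE; have mE := process_history_measurable hE.
under eq_integral do rewrite fimfunE -fsumEFin//.
rewrite ge0_integral_fsum//; last 2 first.
  - move=> r; apply/measurable_EFinP/measurable_funM => //.
    by apply: measurable_funTS; apply: measurableT_comp => //.
  - by move=> r z _; rewrite EFinM nnfun_muleindic_ge0.
under [in RHS]eq_integral.
  move=> w _.
  under eq_integral.
    by move=> z _; rewrite fimfunE -fsumEFin//; over.
  rewrite /= ge0_integral_fsum//; last 2 first.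
    - by move=> r; exact/measurable_EFinP/measurableT_comp.
    - by move=> r z _; rewrite EFinM nnfun_muleindic_ge0.
  under eq_fsbigr.
    move=> r _.
    rewrite (integralZl_indic _ (fun r => h @^-1` [set r]))//; last first.
      by move=> r0; rewrite preimage_nnfun0.
    rewrite integral_indic// setIT.
    over.
  over.
rewrite /= ge0_integral_fsum//; last 2 first.
  - move=> r; apply: measurable_funeM; apply: measurable_funTS.
    exact: measurableT_comp (measurable_kernel kappa (h @^-1` [set r]) _) _.
  - move=> r w _.
    have := mulemu_ge0 (fun r => h @^-1` [set r]).
    by apply; exact: preimage_nnfun0.
apply: eq_fsbigr => r _.
(* A negative value is never taken by [h]: its level set is empty and both terms vanish. *)
have [r0|r0] := leP 0%R r; last first.
  rewrite [RHS]integral0_eq; last first.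
    by move=> w _; rewrite preimage_nnfun0// measure0 mule0.
  by rewrite integral0_eq// => w _; rewrite preimage_nnfun0// indicE in_set0 mulr0.
rewrite ge0_integralZl//; last first.
  apply: measurable_funTS.
  exact: measurableT_comp (measurable_kernel kappa (h @^-1` [set r]) _) _.
under [in LHS]eq_integral do rewrite EFinM.
rewrite ge0_integralZl//; last first.
  by apply/measurable_EFinP/measurable_funTS; exact: measurableT_comp.
rewrite -((X_markov x).2 n E _ hE)//; congr (_ * _)%E.
rewrite (_ : (fun w => _) =
    (fun w => (\1_(X n.+1 @^-1` (h @^-1` [set r])) w)%:E)); last first.
  by apply/funext => w; rewrite !indicE.
rewrite integral_indic//; first by rewrite setIC.
by rewrite -[X in measurable X]setTI; exact: measurable_funP.
Qed.

(** Monotone convergence along simple approximations, under the kernel and under [P x]. *)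
Lemma markov_integral x n E (h : Omega -> \bar R) : process_history X n E ->
  (forall y, 0 <= h y)%E -> measurable_fun setT h ->
  (\int[P x]_(w in E) h (X n.+1 w) =
   \int[P x]_(w in E) \int[kappa (X n w)]_y h y)%E.
Proof.
move=> hE h0 mh; have mE := process_history_measurable hE.
pose h_ := nnsfun_approx measurableT mh.
have hcvg y : (h_ n0 y)%:E @[n0 --> \oo] --> h y.
  by apply: cvg_nnsfun_approx => //.
have h_ge0 k y : (0 <= (h_ k y)%:E)%E by rewrite lee_fin.
have mh_ k : measurable_fun setT (fun y => (h_ k y)%:E) by exact/measurable_EFinP.
have hnd y a b : (a <= b)%N -> ((h_ a y)%:E <= (h_ b y)%:E)%E.
  by move=> ab; rewrite lee_fin; exact/lefP/nd_nnsfun_approx.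
have kint y : (\int[kappa y]_z h z)%E =
    lim ((\int[kappa y]_z (h_ k z)%:E)%E @[k --> \oo]).
  rewrite -monotone_convergence//; last by move=> z _ a b; exact: hnd.
  by apply: eq_integral => z _; apply/esym/cvg_lim.
transitivity (\int[P x]_(w in E) lim ((h_ k (X n.+1 w))%:E @[k --> \oo]))%E.
  by apply: eq_integral => w _; apply/esym/cvg_lim => //; exact: hcvg.
rewrite monotone_convergence//; last 2 first.
- by move=> k; apply: measurable_funTS; exact: measurableT_comp (mh_ k) _.
- by move=> w _ a b; exact: hnd.
under eq_fun do rewrite (markov_nnsfun x _ hE).
under [in RHS]eq_integral do rewrite kint.
rewrite monotone_convergence//.
- move=> k; apply: measurable_funTS.
  exact: measurableT_comp (kernel_measurable (h_ge0 k) (mh_ k)) _.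
- by move=> k w _; exact: kernel_ge0.
- move=> w _ a b ab; apply: ge0_le_integral => // z _; exact: hnd.
Qed.

Lemma markov_initial x (h : Omega -> \bar R) :
  (forall y, 0 <= h y)%E -> measurable_fun setT h ->
  (\int[P x]_w h (X 0%N w) = h x)%E.
Proof.
move=> h0 mh.
have mX : measurable_fun setT (X 0%N) by [].
rewrite -[setT](preimage_setT (X 0%N)).
rewrite -(ge0_integral_pushforward mX)//.
rewrite (@eq_measure_integral _ _ _ _ (\d_x)) => [|B mB _]; last first.
  exact: (X_markov x).1.
by rewrite integral_dirac// diracT mul1e.
Qed.

(** The tail hypotheses concern [X 1] under [P x], while the recursions use [kappa]; this identity
    links the two. *)
Lemma kernel_lawE x (h : Omega -> \bar R) :
  (forall y, 0 <= h y)%E -> measurable_fun setT h ->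
  (\int[kappa x]_y h y = \int[P x]_w h (X 1%N w))%E.
Proof.
move=> h0 mh; rewrite (markov_integral x (@process_historyT 0%N) h0 mh).
rewrite (markov_initial x (h := fun y => \int[kappa y]_z h z)%E)//.
- by move=> y; exact: kernel_ge0.
- exact: kernel_measurable.
Qed.

Section machine.
Context (st : nat -> Omega -> nat) (h : nat -> Omega -> \bar R).
Hypothesis mst : forall j i, measurable [set x | st j x = i].
Hypothesis h0 : forall j x, (0 <= h j x)%E.
Hypothesis mh : forall j, measurable_fun setT (h j).

(** [j] is the state before [x] is read: at time [n] the state has read the letters strictly before
    [n], and the reward sees the letter at [n] separately. *)
Fixpoint machine_value n (j : nat) (x : Omega) : \bar R :=
  if n is n'.+1 then (\int[kappa x]_y machine_value n' (st j x) y)%E else h j x.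

Lemma machine_value_ge0 n j x : (0 <= machine_value n j x)%E.
Proof. by elim: n j x => [|n IH] j x //=; apply: kernel_ge0. Qed.

Lemma measurable_machine_value n j : measurable_fun setT (machine_value n j).
Proof.
elim: n j => [|n IH] j //=.
apply: (measurable_fun_select
  (F := fun i x => (\int[kappa x]_y machine_value n i y)%E)).
  by move=> i; apply: kernel_measurable => // x; exact: machine_value_ge0.
exact: mst.
Qed.

Lemma measurable_machine_run k j n i :
  measurable [set w | machine_run st (fun m => X (k + m)%N w) j n = i].
Proof.
elim: n i => [|n IH] i /=; first exact: measurable_set_cst.
rewrite (_ : [set _ | _] = \bigcup_l
    ([set w | machine_run st (fun m => X (k + m)%N w) j n = l] `&`
     X (k + n)%N @^-1` [set x | st l x = i])); last first.
  apply/seteqP; split => [w /= <-|w [l _ [/= -> //]]].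
  by exists (machine_run st (fun m => X (k + m)%N w) j n).
apply: bigcup_measurable => l _; apply: measurableI => //.
by rewrite -[X in measurable X]setTI; exact: measurable_funP.
Qed.

Lemma measurable_machine_reward k j n : measurable_fun setT (fun w =>
  h (machine_run st (fun m => X (k + m)%N w) j n) (X (k + n)%N w)).
Proof.
apply: (measurable_fun_select (F := fun i w => h i (X (k + n)%N w))).
  by move=> i; exact: measurableT_comp (mh i) _.
by move=> i; exact: measurable_machine_run.
Qed.

(** Induction on [n] by the Markov property at time [k]. All events of the history are allowed
    because the induction restricts to those fixing the next state. *)
Lemma machine_integral x k j n E : process_history X k E ->
  (\int[P x]_(w in E)
     h (machine_run st (fun m => X (k + m)%N w) j n) (X (k + n)%N w) =
   \int[P x]_(w in E) machine_value n j (X k w))%E.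
Proof.
elim: n k j E => [|n IH] k j E hE; first by rewrite addn0.
pose F i := E `&` X k @^-1` [set y | st j y = i].
have hF i : process_history X k (F i) by exact: process_historyI.
have mF i : measurable (F i) by exact: process_history_measurable (hF i).
have EF : E = \bigcup_i F i.
  apply/seteqP; split => [w Ew|w [i _ []]//].
  by exists (st j (X k w)).
have tF : trivIset setT F.
  apply/trivIsetP => a b _ _ ab; apply/seteqP; split => // w [[_ /= wa] [_ /= wb]].
  by move: ab; rewrite -wa wb eqxx.
rewrite EF; rewrite ge0_integral_bigcup//; last first.
  by apply: measurable_funTS; exact: measurable_machine_reward.
rewrite [RHS]ge0_integral_bigcup//; last 2 first.
- apply: measurable_funTS.
  exact: measurableT_comp (measurable_machine_value _ _) _.
- by move=> w _; exact: machine_value_ge0.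
apply: eq_eseriesr => i _.
transitivity (\int[P x]_(w in F i)
    h (machine_run st (fun m => X (k.+1 + m)%N w) i n) (X (k.+1 + n)%N w))%E.
  apply: eq_integral => w /[!inE] -[_ wi]; have {}wi : st j (X k w) = i := wi.
  rewrite machine_runS addSnnS addn0 wi.
  by congr h; congr machine_run; apply/funext => m; rewrite addSnnS.
rewrite IH; last exact: process_historyS.
rewrite markov_integral//; last 2 first.
- by move=> y; exact: machine_value_ge0.
- exact: measurable_machine_value.
by apply: eq_integral => w /[!inE] -[_ /= wi] /=; rewrite wi.
Qed.

End machine.

End markov_chain.

(** * The killed random walk *)

Section killed_walk.
Context (R : realType) (dV : measure_display) (V : measurableType dV)
  (Q : probability V R) (Z1 : {RV Q >-> R}) (S : set R).
Hypothesis S_up : forall s t : R, s <= t -> S s -> S t.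

Lemma measurable_translate (Z : {RV Q >-> R}) (h : R -> \bar R) s :
  {homo h : s t / (s <= t)%R >-> (s <= t)%E} ->
  measurable_fun setT (fun v => h (s + Z v)).
Proof.
move=> hm; apply: measurableT_comp; first exact: homo_measurable.
by apply: measurable_funD.
Qed.

(* The expectation of [g] at time [n] for the [Z1]-walk started at [s] and killed
   when it leaves [S], time [n] included. *)
Fixpoint killed_walk (g : R -> \bar R) n (s : R) : \bar R :=
  if s \in S then
    if n is n'.+1 then (\int[Q]_v killed_walk g n' (s + Z1 v)%R)%E else g s
  else 0%E.

Section fixed_payoff.
Context (g : R -> \bar R).
Hypothesis g_ge0 : forall s, (0 <= g s)%E.
Hypothesis g_le1 : forall s, (g s <= 1)%E.
Hypothesis g_homo : {homo g : s t / (s <= t)%R >-> (s <= t)%E}.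

Lemma killed_walk_ge0 n s : (0 <= killed_walk g n s)%E.
Proof.
elim: n s => [|n IH] s /=; case: ifP => // _.
by apply: integral_ge0 => v _.
Qed.

(** With the same jumps, a walk started higher stays higher, hence remains at least as long in the
    up-set [S]. *)
Lemma killed_walk_homo n :
  {homo killed_walk g n : s t / (s <= t)%R >-> (s <= t)%E}.
Proof.
elim: n => [|n IH] s t st.
  rewrite /=; case: ifPn => [/set_mem Ss|_]; last by case: ifPn.
  by rewrite mem_set ?g_homo//; exact: S_up st Ss.
have := killed_walk_ge0 n.+1 t.
rewrite /=; have [/set_mem Ss _|_ //] := boolP (s \in S).
rewrite mem_set; last exact: S_up st Ss.
apply: ge0_le_integral => //.
- by move=> v _; exact: killed_walk_ge0.
- exact: measurable_translate.
- exact: measurable_translate.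
- by move=> v _; apply: IH; rewrite lerD2r.
Qed.

Lemma killed_walk_le1 n s : (killed_walk g n s <= 1)%E.
Proof.
elim: n s => [|n IH] s /=; case: ifP => // _.
rewrite -(probability_setT Q) -[leRHS]mul1e -integral_cst//.
apply: ge0_le_integral => //.
- by move=> v _; exact: killed_walk_ge0.
- exact: measurable_translate (killed_walk_homo n).
Qed.

Lemma sum_killed_walkS n s :
  (\sum_(k < n.+1) killed_walk g k s =
   if s \in S then g s + \int[Q]_v \sum_(k < n) killed_walk g k (s + Z1 v)%R
   else 0)%E.
Proof.
rewrite big_ord_recl /=; case: ifPn => sS; last first.
  by rewrite add0e big1.
congr (_ + _)%E; rewrite ge0_integral_sum// => k.
- exact: measurable_translate (killed_walk_homo k).
- by move=> v _; exact: killed_walk_ge0.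
Qed.

Lemma sum_killed_walk_homo n :
  {homo (fun s => \sum_(k < n) killed_walk g k s)%E :
    s t / (s <= t)%R >-> (s <= t)%E}.
Proof. by move=> s t st; apply: lee_sum => k _; exact: killed_walk_homo. Qed.

Lemma sum_killed_walk_ge0 n s : (0 <= \sum_(k < n) killed_walk g k s)%E.
Proof. by apply: sume_ge0 => k _; exact: killed_walk_ge0. Qed.

End fixed_payoff.

Lemma killed_walk_le (g g' : R -> \bar R) n s :
  (forall s, 0 <= g s)%E -> {homo g : s t / (s <= t)%R >-> (s <= t)%E} ->
  (forall s, 0 <= g' s)%E -> {homo g' : s t / (s <= t)%R >-> (s <= t)%E} ->
  (forall s, g s <= g' s)%E -> (killed_walk g n s <= killed_walk g' n s)%E.
Proof.
move=> g0 gm g'0 g'm gg'; elim: n s => [|n IH] s /=; case: ifP => // _.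
apply: ge0_le_integral => //.
- by move=> v _; exact: killed_walk_ge0.
- exact: measurable_translate (killed_walk_homo g0 gm n).
- exact: measurable_translate (killed_walk_homo g'0 g'm n).
Qed.

Definition survival := killed_walk (cst 1%E).

Lemma survival_ge0 n s : (0 <= survival n s)%E.
Proof. exact: killed_walk_ge0. Qed.

Lemma survival_homo n : {homo survival n : s t / (s <= t)%R >-> (s <= t)%E}.
Proof. exact: killed_walk_homo. Qed.

Lemma survival_le1 n s : (survival n s <= 1)%E.
Proof. exact: killed_walk_le1. Qed.

Lemma sum_survival_ge0 n s : (0 <= \sum_(k < n) survival k s)%E.
Proof. exact: sum_killed_walk_ge0. Qed.

Lemma measurable_sum_survival (Z : {RV Q >-> R}) n s :
  measurable_fun setT (fun v => \sum_(k < n) survival k (s + Z v))%E.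
Proof.
apply: (measurable_translate Z s (sum_killed_walk_homo (g := cst 1%E) _ _ n)) => //.
Qed.

Lemma survivalS n s : (survival n.+1 s <= survival n s)%E.
Proof.
elim: n s => [|n IH] s.
  by have := survival_le1 1 s; rewrite /survival /=; case: ifP.
rewrite /survival /=; case: ifP => // sS; apply: ge0_le_integral => //.
- by move=> v _; exact: (survival_ge0 n.+1).
- exact: measurable_translate (survival_homo n.+1).
- exact: measurable_translate (survival_homo n).
- by move=> v _; exact: IH.
Qed.

(** Survival is nonincreasing in time, so each of the [n] summands is at least the value at time
    [n]. *)
Lemma survival_sum n s : (n%:R%:E * survival n s <= \sum_(k < n) survival k s)%E.
Proof.
have mono k m : (k <= m)%N -> (survival m s <= survival k s)%E.
  elim: m => [|m IH]; first by rewrite leqn0 => /eqP ->.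
  rewrite leq_eqVlt => /orP[/eqP -> //|]; rewrite ltnS => /IH.
  exact: le_trans (survivalS _ _).
have sumc m (x : \bar R) : (m%:R%:E * x = \sum_(k < m) x)%E.
  elim: m => [|m IHm]; first by rewrite mul0e big_ord0.
  by rewrite big_ord_recr/= -IHm -natr1 EFinD ge0_muleDl ?lee_fin// mul1e.
rewrite sumc.
by apply: lee_sum => k _; apply: mono; exact: ltnW.
Qed.

(* The drift bound holds on [S] only because jumps from [S] stay nonnegative, which
   makes the positive part a Lyapunov function. *)
Lemma sum_survival_le (lambda1 : R) n s : 0 < lambda1 ->
  (forall s, S s -> 0 <= s) ->
  (forall s, S s ->
    (\int[Q]_v (Num.max (s + Z1 v) 0)%:E <= (s - lambda1)%:E)%E) ->
  (lambda1%:E * \sum_(k < n) survival k s <= (Num.max s 0)%:E)%E.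
Proof.
move=> l0 S0 drift; elim: n s => [|n IH] s.
  by rewrite big_ord0 mule0 lee_fin le_max lexx orbT.
rewrite /survival sum_killed_walkS// -/survival.
case: ifPn => [/set_mem Ss|_]; last first.
  by rewrite mule0 lee_fin le_max lexx orbT.
have sge0 v := sum_survival_ge0 n (s + Z1 v).
have mW := measurable_sum_survival Z1 n s.
rewrite ge0_muleDr//; last by apply: integral_ge0 => v _; exact: sge0.
rewrite mule1 -ge0_integralZl//; last by rewrite lee_fin ltW.
rewrite (max_idPl (S0 _ Ss)).
(* Of the height [s], the part [lambda1] pays for the present step and the rest bounds the mean
   positive part after it. *)
rewrite -[s in leRHS](subrKC lambda1) EFinD.
rewrite leeD2l//; apply: le_trans (drift _ Ss).
apply: ge0_le_integral => //.
- by move=> v _; rewrite mule_ge0// lee_fin ltW.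
- exact: measurable_funeM.
- apply/measurable_EFinP; apply: measurable_maxr => //.
  exact: measurable_funD.
Qed.

End killed_walk.

(** * Expected time above a high level *)

Lemma ereal_cvg0_lt (R : realType) (u : nat -> \bar R) (delta : R) : 0 < delta ->
  u n @[n --> \oo] --> 0%E -> \forall n \near \oo, (u n < delta%:E)%E.
Proof.
move=> d0 u0; apply: (u0 [set x | x < delta%:E]%E).
by apply: open_ereal_lt'; rewrite lte_fin.
Qed.

(** The majorant [B] has a small tail beyond some [N], whatever [i] is, and the finitely many terms
    before [N] tend to 0. Hence one [i] serves every horizon [n]. *)
Lemma tannery0 (R : realType) (b : nat -> nat -> \bar R) (B : nat -> \bar R)
    (C delta : R) : 0 < delta ->
  (forall i k, 0 <= b i k <= B k)%E ->
  (forall n, \sum_(0 <= k < n) B k <= C%:E)%E ->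
  (forall k, b i k @[i --> \oo] --> 0%E) ->
  \forall i \near \oo, forall n, (\sum_(k < n) b i k <= delta%:E)%E.
Proof.
move=> d0 bB BC bcvg.
have B0 k : (0 <= B k)%E by have /andP[] := bB 0%N k; exact: le_trans.
have BS : (\sum_(0 <= k <oo) B k < +oo)%E.
  rewrite (@le_lt_trans _ _ C%:E) ?ltry//.
  by apply: lime_le; [exact: is_cvg_nneseries|exact: nearW].
have d2 : 0 < delta / 2 by rewrite divr_gt0.
have [N _ /(_ N (leqnn N)) tail] :=
  ereal_cvg0_lt d2 (nneseries_tail_cvg BS (fun k _ => B0 k)).
have hcvg : (\sum_(k <- index_iota 0 N) b i k)%E @[i --> \oo] --> 0%E.
  rewrite [X in _ --> X](_ : _ = \sum_(k <- index_iota 0 N) (0 : \bar R))%E; last first.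
    by rewrite big1.
  apply: (cvg_nnesum (f := fun k i => b i k)) => // k _.
  by apply: nearW => i; have /andP[] := bB i k.
have := ereal_cvg0_lt d2 hcvg.
apply: filterS => i head n.
rewrite (splitr delta) EFinD.
apply: le_trans (leeD (ltW head) (ltW tail)).
have hle : (\sum_(k < n) b i k <= \sum_(0 <= k < N + n) b i k)%E.
  rewrite -(big_mkord xpredT (b i)); apply: lee_sum_nneg_natr => //.
    by move=> k _ _; have /andP[] := bB i k.
  exact: leq_addl.
apply: le_trans hle _.
rewrite (big_cat_nat (n := N))//= ?leq_addr// leeD2l//.
apply: le_trans (nneseries_lim_ge (N + n) _) => //.
by apply: lee_sum => k _; have /andP[] := bB i k.
Qed.

Definition above (R : realType) (r s : R) : \bar R := ((r < s)%R%:R)%:E.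

Section above.
Context (R : realType) (dV : measure_display) (V : measurableType dV)
  (Q : probability V R) (Z0 Z1 : {RV Q >-> R}) (S : set R).
Hypothesis S_up : forall s t : R, s <= t -> S s -> S t.

Lemma above_ge0 (r s : R) : (0 <= above r s)%E.
Proof. by rewrite lee_fin. Qed.

Lemma above_le1 (r s : R) : (above r s <= 1)%E.
Proof. by rewrite lee_fin lern1 leq_b1. Qed.

Lemma above_homo (r : R) : {homo above r : s t / (s <= t)%R >-> (s <= t)%E}.
Proof.
move=> s t st; rewrite lee_fin ler_nat; case: (ltP r s) => //= rs.
by rewrite (lt_le_trans rs st).
Qed.

Let walk r := killed_walk Z1 S (above r).
Let walk_ge0 r n s : (0 <= walk r n s)%E.
Proof. by apply: killed_walk_ge0; exact: above_ge0. Qed.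
Let walk_le1 r n s : (walk r n s <= 1)%E.
Proof.
apply: killed_walk_le1 => //.
- exact: above_ge0.
- exact: above_le1.
- exact: above_homo.
Qed.
Let walk_homo r n : {homo walk r n : s t / (s <= t)%R >-> (s <= t)%E}.
Proof. by apply: killed_walk_homo => //; [exact: above_ge0|exact: above_homo]. Qed.

Let walk_translate_cvg0 (Z : {RV Q >-> R}) n (a : R) :
  (forall s, walk i%:R n s @[i --> \oo] --> 0%E) ->
  (\int[Q]_v walk i%:R n (a + Z v))%E @[i --> \oo] --> 0%E.
Proof.
move=> h; have [] := @dominated_convergence _ _ _ Q _ measurableT
  (fun i v => walk i%:R n (a + Z v)) (cst 0%E) (cst 1%E).
- by move=> i; exact: measurable_translate (walk_homo _ n).
- by [].
- by apply: aeW => v _; exact: h.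
- exact: finite_measure_integrable_cst.
- by apply: aeW => v i _; rewrite gee0_abs.
- by move=> _ _; rewrite integral0.
Qed.

(** Dominated convergence at each step; at time 0 the payoff vanishes once [i] exceeds [s]. *)
Lemma killed_walk_above_cvg0 n s :
  killed_walk Z1 S (above i%:R) n s @[i --> \oo] --> 0%E.
Proof.
elim: n s => [|n IH] s /=; case: (s \in S); rewrite ?[X in X @ _]/=; last 3 first.
- exact: cvg_cst.
- exact: walk_translate_cvg0.
- exact: cvg_cst.
apply: cvg_near_cst; exists (Num.truncn s).+1 => // i /= si.
rewrite /above ltNge (le_trans (ltW (truncnS_gt s)))//.
by rewrite ler_nat.
Qed.

Lemma integral_killed_walk_above_cvg0 n (a : R) :
  (\int[Q]_v killed_walk Z1 S (above i%:R) n (a + Z0 v)%R)%E @[i --> \oo] --> 0%E.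
Proof. by apply: walk_translate_cvg0 => s; exact: killed_walk_above_cvg0. Qed.

(** This makes the excursion cost [b r] small, by [tannery0] with the survival probabilities as
    majorant. *)
Lemma sum_killed_walk_above_small (C a delta : R) : 0 < delta ->
  (forall n, \int[Q]_v \sum_(k < n) survival Z1 S k (a + Z0 v)%R <= C%:E)%E ->
  \forall i \near \oo, forall n,
    (\sum_(k < n) \int[Q]_v killed_walk Z1 S (above i%:R) k (a + Z0 v)%R
     <= delta%:E)%E.
Proof.
move=> d0 hC.
have ms k := measurable_translate Z0 a (survival_homo Z1 S_up k).
apply: (tannery0
  (b := fun i k => (\int[Q]_v killed_walk Z1 S (above i%:R) k (a + Z0 v)%R)%E)
  (B := fun k => (\int[Q]_v survival Z1 S k (a + Z0 v)%R)%E) (C := C)) => //.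
- move=> i k; apply/andP; split; first by apply: integral_ge0 => v _; exact: walk_ge0.
  apply: ge0_le_integral => //.
  + by move=> v _; exact: walk_ge0.
  + exact: measurable_translate (walk_homo _ k).
  + move=> v _; apply: killed_walk_le => //.
    * exact: above_ge0.
    * exact: above_homo.
    * exact: above_le1.
- move=> n; rewrite big_mkord.
  rewrite -(ge0_integral_sum Q measurableT
    (f := fun (k : 'I_n) v => survival Z1 S k (a + Z0 v))) => [|k|k v _]; first exact: hC.
  + exact: ms.
  + exact: survival_ge0.
- by move=> k; exact: integral_killed_walk_above_cvg0.
Qed.

End above.

(** * Comparison of the chain with the walk *)

(** Lowering all arguments by one drops the top term and brings in one more [a 0], since truncated
    subtraction stops at 0. After [q] rounds at most [q] such terms have entered. *)
Lemma sum_shift_le (R : realType) (a : nat -> \bar R) (M : \bar R) (q D : nat) :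
  (forall c, 0 <= a c)%E -> (a 0%N <= M)%E ->
  (\sum_(1 <= c < D.+1) a (c - q)%N <= q%:R%:E * M + \sum_(1 <= c < D.+1) a c)%E.
Proof.
move=> a0 aM; elim: q => [|q IH].
  by rewrite mul0e add0e; under eq_bigr do rewrite subn0.
have M0 : (0 <= M)%E by exact: le_trans aM.
rewrite -natr1 EFinD ge0_muleDl ?lee_fin// mul1e [X in (X + _)%E]addeC -addeA.
apply: (@le_trans _ _ (M + \sum_(1 <= c < D.+1) a (c - q)%N)%E); last exact: leeD2l.
rewrite big_add1/= (eq_bigr (fun c => a (c - q)%N)) => [|c _]; last first.
  by rewrite subSS.
apply: (@le_trans _ _ (\sum_(0 <= c < D.+1) a (c - q)%N)%E).
  by rewrite [leRHS]big_nat_recr//= leeDl.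
by rewrite [leLHS]big_ltn//; exact: leeD2r.
Qed.

Section relay.
Context (R : realType) (dV : measure_display) (V : measurableType dV)
  (Q : probability V R) (Z1 : {RV Q >-> R}) (S : set R) (r : R) (q : nat)
  (Psi : nat -> \bar R).
Hypothesis S_up : forall s t : R, s <= t -> S s -> S t.
Hypothesis Psi_ge0 : forall c, (0 <= Psi c)%E.
Hypothesis Psi_noninc : {homo Psi : c d / (c <= d)%N >-> (d <= c)%E}.

(* The expectation of [Psi] at the budget that remains when the [Z1]-walk started
   at [s] first leaves [S] (or after [n] steps), each step from above [r] costing
   [q]. *)
Fixpoint relay n (s : R) (c : nat) : \bar R :=
  if n is n'.+1 then
    if s \in S then
      (\int[Q]_v relay n' (s + Z1 v)%R (if (r < s)%R then c - q else c)%N)%E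
    else Psi c
  else Psi c.

Let spend s c := (if (r < s)%R then c - q else c)%N.

Let spend_le s c : (spend s c <= c)%N.
Proof. by rewrite /spend; case: ifP => // _; exact: leq_subr. Qed.

Let spend_homo s c d : (c <= d)%N -> (spend s c <= spend s d)%N.
Proof. by rewrite /spend; case: ifP => // _ /(leq_sub2r q). Qed.

Let spend_anti s t c : s <= t -> (spend t c <= spend s c)%N.
Proof.
move=> st; rewrite /spend; case: (ltP r s) => [rs|_].
  by rewrite (lt_le_trans rs st).
exact: spend_le.
Qed.

Lemma relay_ge0 n s c : (0 <= relay n s c)%E.
Proof.
elim: n s c => [|n IH] s c //=; case: ifP => // _.
by apply: integral_ge0 => v _.
Qed.

(** The three facts need one another: passing from outside [S] to inside uses the lower bound by
    [Psi], and a higher start may pay [q] where a lower one does not, so monotonicity in the budget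
    is required. *)
Lemma relay_homo n :
  (forall c, {homo relay n ^~ c : s t / (s <= t)%R >-> (s <= t)%E}) /\
  forall s c, (Psi c <= relay n s c)%E /\
    forall d, (c <= d)%N -> (relay n s d <= relay n s c)%E.
Proof.
elim: n => [|n [IHs IHc]].
  by split=> [c s t _|s c]; [exact: lexx|split=> // d; exact: Psi_noninc].
have mR s t c : measurable_fun setT (fun v => relay n (s + Z1 v) (spend t c)).
  exact: measurable_translate (IHs _).
have Psi_le s c : (Psi c <= relay n.+1 s c)%E.
  rewrite /=; case: ifPn => // sS.
  rewrite -[leLHS]mule1 -(probability_setT Q) -integral_cst//.
  apply: ge0_le_integral => //; [by move=> v _; exact: Psi_ge0|exact: mR|].
  move=> v _; apply: le_trans (IHc _ _).1.
  exact: Psi_noninc (spend_le _ _).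
split => [c s t st|s c]; last (split=> // d cd).
  rewrite [leLHS]/=; case: ifPn => [/set_mem Ss|sS]; last first.
    exact: Psi_le.
  rewrite /= mem_set; last exact: S_up st Ss.
  apply: ge0_le_integral => //.
  - by move=> v _; exact: relay_ge0.
  - exact: mR.
  - exact: mR.
  - move=> v _; apply: (@le_trans _ _ (relay n (t + Z1 v) (spend s c))).
      by apply: IHs; rewrite lerD2r.
    exact: (IHc _ _).2 (spend_anti _ st).
rewrite /=; case: ifPn => [sS|_]; last exact: Psi_noninc.
apply: ge0_le_integral => //.
- by move=> v _; exact: relay_ge0.
- exact: mR.
- exact: mR.
- by move=> v _; exact: (IHc _ _).2 (spend_homo _ cd).
Qed.

Lemma measurable_relay (Z : {RV Q >-> R}) n s c :
  measurable_fun setT (fun v => relay n (s + Z v) c).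
Proof. exact: measurable_translate ((relay_homo n).1 c). Qed.

Lemma relay_le n s c : (relay n s c <= Psi 0%N)%E.
Proof.
elim: n s c => [|n IH] s c /=; first exact: Psi_noninc.
case: ifPn => _; last exact: Psi_noninc.
rewrite -[leRHS]mule1 -(probability_setT Q) -integral_cst//.
apply: ge0_le_integral => //.
- by move=> v _; exact: relay_ge0.
- exact: measurable_relay.
Qed.

(** A step above [r] shifts every budget by [q], which by [sum_shift_le] costs at most [q * Psi 0]
    in the sum over budgets. The killed walk counts the expected number of such steps. *)
Lemma sum_relay_le n s D :
  (\sum_(1 <= c < D.+1) relay n s c <= \sum_(1 <= c < D.+1) Psi c +
     q%:R%:E * Psi 0%N * \sum_(k < n) killed_walk Z1 S (above r) k s)%E.
Proof.
have a0 := @above_ge0 R r; have ah := @above_homo R r.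
have qP : (0 <= q%:R%:E * Psi 0%N)%E by rewrite mule_ge0// lee_fin.
elim: n s => [|n IH] s; first by rewrite big_ord0 mule0 adde0.
rewrite sum_killed_walkS//= ; case: ifPn => sS; last first.
  by rewrite mule0 adde0.
rewrite -ge0_integral_sum//; last 2 first.
- by move=> c; exact: measurable_relay.
- by move=> c v _; exact: relay_ge0.
have w0 v := sum_killed_walk_ge0 Z1 S a0 n (s + Z1 v).
have mw := measurable_translate Z1 s (sum_killed_walk_homo Z1 S_up a0 ah n).
have sP0 : (0 <= \sum_(1 <= c < D.+1) Psi c)%E by apply: sume_ge0.
rewrite ge0_muleDr//; last by apply: integral_ge0 => v _; exact: w0.
rewrite -ge0_integralZl// addeCA.
rewrite -[X in (X + _)%E]mule1 -{1}(probability_setT Q) -integral_cst//.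
rewrite -[X in (_ + (X + _))%E]mule1 -{1}(probability_setT Q) -integral_cst//.
rewrite -ge0_integralD//; last 2 first.
- by move=> v _; rewrite mule_ge0.
- exact: measurable_funeM.
rewrite -ge0_integralD//; last 3 first.
- by move=> v _; rewrite /= mule_ge0.
- by move=> v _; rewrite adde_ge0// mule_ge0.
- by apply: emeasurable_funD => //; exact: measurable_funeM.
apply: ge0_le_integral => //.
- by move=> v _; apply: sume_ge0 => c _; exact: relay_ge0.
- by apply: emeasurable_sum => c; exact: measurable_relay.
- apply: emeasurable_funD => //; apply: emeasurable_funD => //.
  exact: measurable_funeM.
move=> v _; rewrite /= /above; case: (r < s); last first.
  by rewrite mule0 add0e; exact: IH.
rewrite mule1; apply: (@le_trans _ _ (q%:R%:E * Psi 0%N +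
    \sum_(1 <= c < D.+1) relay n (s + Z1 v) c)%E); last by rewrite leeD2l.
apply: sum_shift_le; first by move=> c; exact: relay_ge0.
exact: relay_le.
Qed.

End relay.

Lemma measurable_if_nat (d : measure_display) (T : measurableType d)
    (b : T -> bool) (u v : T -> nat) :
  measurable [set x | b x] -> (forall i, measurable [set x | u x = i]) ->
  (forall i, measurable [set x | v x = i]) ->
  forall i, measurable [set x | (if b x then u x else v x) = i].
Proof.
move=> mb mu mv i.
rewrite (_ : [set x | _] = ([set x | b x] `&` [set x | u x = i]) `|`
    (~` [set x | b x] `&` [set x | v x = i])); last first.
  apply/seteqP; split => x /=; case: (b x).
  - by left.
  - by right.
  - by move=> [[_ ->]|[]].
  - by move=> [[]|[_ ->]].
apply: measurableU; apply: measurableI => //; exact: measurableC.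
Qed.

Lemma measurable_preimage_up (d : measure_display) (T : measurableType d)
    (R : realType) (f : {mfun T >-> R}) (S : set R) :
  (forall s t : R, s <= t -> S s -> S t) -> measurable [set x | f x \in S].
Proof.
move=> S_up; rewrite (_ : [set x | _] = f @^-1` S); last first.
  by apply/seteqP; split => x /=; rewrite inE.
rewrite -[X in measurable X]setTI; apply: measurable_funP => //.
apply: is_interval_measurable => s t Ss _ u /andP[su _]; exact: S_up su Ss.
Qed.

Section comparison.
Context (R : realType) (dS : measure_display) (Omega : measurableType dS)
  (kappa : R.-pker Omega ~> Omega) (f : {mfun Omega >-> R})
  (dV : measure_display) (V : measurableType dV)
  (Q : probability V R) (Z0 Z1 : {RV Q >-> R}) (S : set R) (R0 : R).
Hypothesis S_up : forall s t : R, s <= t -> S s -> S t.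

(** Test functions replace tails because domination is applied to value functions of the walk at the
    next position. *)
Definition dominated_at (x : Omega) (Z : V -> R) :=
  forall (h : R -> \bar R) (C : R),
  (forall s, 0 <= h s)%E -> (forall s, h s <= C%:E)%E ->
  {homo h : s t / (s <= t)%R >-> (s <= t)%E} ->
  (\int[kappa x]_y h (f y) <= \int[Q]_v h (Z v))%E.

Hypothesis dom_out : forall x, S (f x) -> dominated_at x (fun v => f x + Z1 v).
Hypothesis dom_in : forall x, ~ S (f x) -> dominated_at x (fun v => R0 + Z0 v).

Let mf (h : R -> \bar R) : {homo h : s t / (s <= t)%R >-> (s <= t)%E} ->
  measurable_fun setT (fun y => h (f y)).
Proof. by move=> hm; apply: measurableT_comp => //; exact: homo_measurable. Qed.

Let mSf := measurable_preimage_up f S_up.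

Section fixed_level.
Context (r : R).
Hypothesis rS : forall x, r < f x -> S (f x).

Let a0 := @above_ge0 R r.
Let a1 := @above_le1 R r.
Let ah := @above_homo R r.

Let wcost k := (\int[Q]_v killed_walk Z1 S (above r) k (R0 + Z0 v)%R)%E.

Let wcost_ge0 k : (0 <= wcost k)%E.
Proof. by apply: integral_ge0 => v _; exact: killed_walk_ge0. Qed.

(* The sum runs over the time elapsed since the last visit to [K]. *)
Lemma tail_prob_le n x :
  (machine_value kappa (fun j _ => j) (fun _ x => above r (f x)) n 0%N x <=
   killed_walk Z1 S (above r) n (f x) + \sum_(k < n) wcost k)%E.
Proof.
elim: n x => [|n IH] x.
  rewrite big_ord0 adde0 /=; case: ifPn => // /negP Sfx.
  (* A point outside [S] is not above [r], so both sides are 0. *)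
  by rewrite /above; case: (ltP r (f x)) => // /rS/mem_set.
have sum0 : (0 <= \sum_(k < n) wcost k)%E by exact: sume_ge0.
apply: (@le_trans _ _ (\int[kappa x]_y killed_walk Z1 S (above r) n (f y) +
   \sum_(k < n) wcost k)%E).
  rewrite -[X in (_ <= _ + X)%E]mule1 -(@prob_kernel _ _ _ _ _ kappa x).
  rewrite -integral_cst// -ge0_integralD//; last 2 first.
  - by move=> y _; exact: killed_walk_ge0.
  - by apply: mf; exact: killed_walk_homo.
  apply: ge0_le_integral => //.
  - by move=> y _; apply: machine_value_ge0.
  - apply: measurable_machine_value => //.
    + by move=> j i; exact: measurable_set_cst.
    + by move=> j; apply: mf.
  - apply: emeasurable_funD => //; apply: mf; exact: killed_walk_homo.
have Wb s : (killed_walk Z1 S (above r) n s <= 1%:E)%E by exact: killed_walk_le1.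
have W0 s : (0 <= killed_walk Z1 S (above r) n s)%E by exact: killed_walk_ge0.
have Wh : {homo killed_walk Z1 S (above r) n : s t / (s <= t)%R >-> (s <= t)%E}.
  exact: killed_walk_homo.
(* From [S], one step of the chain is compared with one step of the walk; from [K] an excursion
   starts, which is the new summand [wcost n]. *)
have [Sfx|Sfx] := pselect (S (f x)).
  rewrite [in leRHS]/= mem_set// leeD//; first exact: dom_out Wb Wh.
  by rewrite big_ord_recr/= leeDl.
rewrite big_ord_recr/= memNset// add0e addeC leeD2l//.
exact: dom_in Wb Wh.
Qed.

(** * Expected number of visits to [K] with an empty budget *)

Section budget.
Context (q N : nat).

Definition budget_step (c : nat) (x : Omega) : nat :=
  if f x \in S then (if r < f x then (c - q)%N else c) else c.+1.

(* After the last visit to [K] with an empty budget the truncation in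
   [budget_step] no longer acts. *)
Definition broke (c : nat) (x : Omega) : \bar R :=
  (((c == 0%N) && (f x \notin S))%:R)%:E.

Definition broke_count n c x :=
  (\sum_(i < n) machine_value kappa budget_step broke i c x)%E.

Lemma measurable_budget_step j i : measurable [set x | budget_step j x = i].
Proof.
apply: (measurable_if_nat mSf) => {}i; last exact: measurable_set_cst.
apply: (measurable_if_nat (measurable_gt f r)) => {}i; exact: measurable_set_cst.
Qed.

Lemma broke_ge0 c x : (0 <= broke c x)%E.
Proof. by rewrite lee_fin. Qed.

Lemma measurable_broke c : measurable_fun setT (broke c).
Proof.
apply/measurable_EFinP; case: c => [|c]; last exact: measurable_cst.
rewrite (_ : (fun _ => _) = \1_(~` [set x | f x \in S])); last first.
  apply/funext => x; rewrite indicE in_setC /=; congr (~~ _)%:R.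
  by apply/idP/idP => [xS|/set_mem//]; rewrite inE.
by apply: measurable_indic; exact: measurableC.
Qed.

Let mO i c := measurable_machine_value kappa measurable_budget_step
  broke_ge0 measurable_broke i c.
Let O0 i c x := machine_value_ge0 kappa budget_step broke_ge0 i c x.

Lemma broke_count_ge0 n c x : (0 <= broke_count n c x)%E.
Proof. by apply: sume_ge0 => i _; exact: O0. Qed.

Lemma measurable_broke_count n c : measurable_fun setT (broke_count n c).
Proof. by apply: emeasurable_sum => i; exact: mO. Qed.

Lemma broke_countS n c x : (broke_count n.+1 c x =
  broke c x + \int[kappa x]_y broke_count n (budget_step c x) y)%E.
Proof.
rewrite /broke_count big_ord_recl/=; congr (_ + _)%E.
by rewrite ge0_integral_sum.
Qed.

Lemma broke_count_le n c x : (broke_count n c x <= n%:R%:E)%E.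
Proof.
elim: n c x => [|n IH] c x; first by rewrite /broke_count big_ord0.
rewrite broke_countS -natr1 EFinD addeC.
apply: leeD; first by rewrite -[leRHS]/(1%:E) lee_fin lern1 leq_b1.
rewrite -[leRHS]mule1 -(@prob_kernel _ _ _ _ _ kappa x) -integral_cst//.
apply: ge0_le_integral => //.
- by move=> y _; exact: broke_count_ge0.
- exact: measurable_broke_count.
Qed.

Lemma broke_count_mono n m c x : (n <= m)%N ->
  (broke_count n c x <= broke_count m c x)%E.
Proof.
move=> nm; rewrite /broke_count.
rewrite -!(big_mkord xpredT (fun i => machine_value kappa budget_step broke i c x)).
by apply: lee_sum_nneg_natr => // k _ _; exact: O0.
Qed.

(** [budget_step] is nondecreasing in the budget, so along any path a richer start stays at least as
    rich. *)
Lemma broke_count_anti n c d x : (c <= d)%N ->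
  (broke_count n d x <= broke_count n c x)%E.
Proof.
elim: n c d x => [|n IH] c d x cd; first by rewrite /broke_count !big_ord0.
rewrite !broke_countS leeD//.
  rewrite lee_fin ler_nat /=; case: (_ \notin _); rewrite ?andbF// !andbT.
  by case: c cd => [|c]; case: d => //.
apply: ge0_le_integral => //.
- by move=> y _; exact: broke_count_ge0.
- exact: measurable_broke_count.
- exact: measurable_broke_count.
move=> y _; apply: IH; rewrite /budget_step.
by do 2 case: ifP => // _; exact: leq_sub2r.
Qed.

(** At most [q * n] is spent in [n] steps. This kills the boundary term of the telescoping sum. *)
Lemma broke_count0 n c x : (q * n < c)%N -> broke_count n c x = 0%E.
Proof.
elim: n c x => [|n IH] c x; first by rewrite /broke_count big_ord0.
rewrite mulnS => nc; rewrite broke_countS integral0_eq ?adde0.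
  by rewrite /broke; case: c nc.
move=> y _; apply: IH; rewrite /budget_step.
case: ifP => _; last first.
  by apply: leq_trans (leqnSn _); rewrite (leq_ltn_trans _ nc)// leq_addl.
case: ifP => _; last by rewrite (leq_ltn_trans _ nc)// leq_addl.
by rewrite ltn_subRL.
Qed.

(* The element 0 keeps the supremum nonnegative when [K] is empty. *)
Definition worst c : \bar R :=
  ereal_sup [set z | z = 0%E \/ exists2 x, ~ S (f x) & z = broke_count N c x].

Lemma worst_ge0 c : (0 <= worst c)%E.
Proof. by apply: ereal_sup_ubound; left. Qed.

Lemma worst_ge c x : ~ S (f x) -> (broke_count N c x <= worst c)%E.
Proof. by move=> Sx; apply: ereal_sup_ubound; right; exists x. Qed.

Lemma worst_le c (z : \bar R) : (0 <= z)%E ->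
  (forall x, ~ S (f x) -> broke_count N c x <= z)%E -> (worst c <= z)%E.
Proof. by move=> z0 h; apply: ge_ereal_sup => _ [->//|[x Sx ->]]; exact: h. Qed.

Lemma worst_noninc : {homo worst : c d / (c <= d)%N >-> (d <= c)%E}.
Proof.
move=> c d cd; apply: worst_le => [|x Sx]; first exact: worst_ge0.
by apply: le_trans (worst_ge _ Sx); exact: broke_count_anti.
Qed.

Let rel := relay Z1 S r q worst.
Let rel_ge0 n s c : (0 <= rel n s c)%E.
Proof. by apply: relay_ge0; exact: worst_ge0. Qed.
Let rel_le n s c : (rel n s c <= worst 0%N)%E.
Proof. by apply: relay_le => //; [exact: worst_ge0|exact: worst_noninc]. Qed.
Let rel_homo n c : {homo rel n ^~ c : s t / (s <= t)%R >-> (s <= t)%E}.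
Proof.
exact: (relay_homo Z1 r q S_up worst_ge0 worst_noninc n).1 c.
Qed.
Let worst_fin c : (worst c <= N%:R%:E)%E.
Proof. by apply: worst_le => [|x _]; [rewrite lee_fin|exact: broke_count_le]. Qed.

(** The chain is followed to its first visit to [K], and [worst] bounds what comes after: the
    remaining horizon is at most [N]. *)
Lemma broke_count_relay n c x : (n <= N)%N ->
  (broke_count n c x <= rel n (f x) c)%E.
Proof.
elim: n c x => [|n IH] c x nN; first by rewrite /broke_count big_ord0.
have [Sfx|Sfx] := pselect (S (f x)); last first.
  rewrite /rel/= memNset//; apply: le_trans (worst_ge _ Sfx).
  exact: broke_count_mono.
rewrite broke_countS /broke /budget_step /rel/= mem_set//= andbF add0e.
set d := (if _ then _ else _).
have /(_ N%:R) := @dom_out _ Sfx (rel n ^~ d).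
move=> /(_ (fun s => rel_ge0 n s d) (fun s => le_trans (rel_le n s d) (worst_fin _))
  (rel_homo n d)).
apply: le_trans; apply: ge0_le_integral => //.
- by move=> y _; exact: broke_count_ge0.
- exact: measurable_broke_count.
- exact: (mf (rel_homo n d)).
- by move=> y _; apply: IH; exact: ltnW.
Qed.

(** Telescoping gives [worst 0 <= 1 + worst 0 / 2]. The horizon [N] keeps [worst] finite, and the
    bound 2 does not depend on it. *)
Lemma broke_count_le2 (n : nat) c x :
  (forall m, \sum_(k < m) wcost k <= (2 * q%:R)^-1%:E)%E ->
  (0 < q)%N -> (n <= N)%N ->
  (broke_count n c x <= 2%:E)%E.
Proof.
move=> wsmall q0 nN.
apply: (@le_trans _ _ (rel n (f x) c)); first exact: broke_count_relay.
apply: le_trans (rel_le _ _ _) _.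
(* The visit to [K] earns 1, hence [d.+1]. The horizon is enlarged to [N.+1] so that peeling off the
   first step leaves [N]. *)
have step d : (worst d <= ((d == 0%N)%:R)%:E + \int[Q]_v rel N (R0 + Z0 v)%R d.+1)%E.
  apply: worst_le => [|y Sy].
    by rewrite adde_ge0 ?lee_fin//; apply: integral_ge0 => v _.
  apply: le_trans (broke_count_mono _ _ (leqnSn N)) _.
  rewrite broke_countS leeD//.
    by rewrite lee_fin ler_nat; case: eqP => //=; case: (_ \notin _).
  rewrite /budget_step memNset//.
  apply: le_trans (dom_in Sy (h := rel N ^~ d.+1) (C := N%:R) _ _ _) => //.
  + apply: ge0_le_integral => //.
    * by move=> z _; exact: broke_count_ge0.
    * exact: measurable_broke_count.
    * exact: (mf (rel_homo N d.+1)).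
    * by move=> z _; exact: broke_count_relay.
  + by move=> s; exact: le_trans (worst_fin 0%N).
(* The most that [N] steps can spend, so that [worst D.+1] is 0. *)
set D := (q * N)%N.
have mrel c' : measurable_fun setT (fun v => rel N (R0 + Z0 v) c').
  exact: measurable_translate (@rel_homo N c').
have wD : worst D.+1 = 0%E.
  apply/eqP; rewrite eq_le worst_ge0 andbT; apply: worst_le => // y _.
  by rewrite broke_count0.
(* Summing [step] over [d] makes all but the terms [worst 0] and
   [worst D.+1] cancel. *)
have total : (\sum_(0 <= d < D.+1) worst d <= 1 + (\sum_(1 <= d < D.+2) worst d +
    q%:R%:E * worst 0%N * (2 * q%:R)^-1%:E))%E.
  apply: (@le_trans _ _ (\sum_(0 <= d < D.+1) (((d == 0%N)%:R)%:E +
     \int[Q]_v rel N (R0 + Z0 v)%R d.+1))%E); first by apply: lee_sum => d _.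
  rewrite big_split/= leeD//.
    by rewrite big_ltn//= big1_seq ?adde0// => d; rewrite mem_index_iota; case: d.
  have -> : (\sum_(0 <= d < D.+1) \int[Q]_v rel N (R0 + Z0 v)%R d.+1 =
      \int[Q]_v \sum_(1 <= d < D.+2) rel N (R0 + Z0 v)%R d)%E.
    by rewrite ge0_integral_sum// big_add1.
  have w0 v : (0 <= \sum_(k < N) killed_walk Z1 S (above r) k (R0 + Z0 v))%E.
    exact: sum_killed_walk_ge0.
  have mw := measurable_translate Z0 R0 (sum_killed_walk_homo Z1 S_up a0 ah N).
  have qw0 : (0 <= q%:R%:E * worst 0%N)%E by rewrite mule_ge0// ?lee_fin// worst_ge0.
  have sw0 : (0 <= \sum_(1 <= d < D.+2) worst d)%E.
    by apply: sume_ge0 => d _; exact: worst_ge0.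
  apply: (@le_trans _ _ (\int[Q]_v (\sum_(1 <= d < D.+2) worst d + q%:R%:E * worst 0%N *
      \sum_(k < N) killed_walk Z1 S (above r) k (R0 + Z0 v)%R))%E).
    apply: ge0_le_integral => //.
    - by move=> v _; apply: sume_ge0 => d _; exact: rel_ge0.
    - by apply: emeasurable_sum => d; exact: mrel.
    - by apply: emeasurable_funD => //; exact: measurable_funeM.
    - move=> v _; apply: sum_relay_le => //.
      + exact: worst_ge0.
      + exact: worst_noninc.
  rewrite ge0_integralD//; last 2 first.
  - by move=> v _; rewrite mule_ge0.
  - exact: measurable_funeM.
  rewrite integral_cst// [X in (_ * X)%E](probability_setT Q) mule1 leeD2l//.
  rewrite ge0_integralZl// lee_wpmul2l//.
  rewrite ge0_integral_sum//.
  - by move=> k; exact: measurable_translate (killed_walk_homo Z1 S_up a0 ah k).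
  - by move=> k v _; exact: killed_walk_ge0.
(* Finiteness allows the common sum of [worst d] over [1 <= d <= D] to be cancelled. *)
have fin c' : worst c' \is a fin_num.
  by rewrite ge0_fin_numE ?worst_ge0// (le_lt_trans (worst_fin c'))// ltry.
move: total; rewrite big_ltn// [in leRHS]big_nat_recr//= wD adde0.
have : (\sum_(1 <= d < D.+1) worst d)%E \is a fin_num.
  by apply/sum_fin_numP => d _ _; exact: fin.
move=> /fineK <-; rewrite -(fineK (fin 0%N)) -!EFinM -!EFinD !lee_fin.
set w := fine _; set A := fine _.
rewrite (_ : q%:R * w * (2 * q%:R)^-1 = w / 2); last by field; rewrite pnatr_eq0 -lt0n.
lra.
Qed.

End budget.
End fixed_level.
End comparison.

(** * Confinement outside the sublevel set *)

Section confinement.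
Context (R : realType) (dS : measure_display) (Omega : measurableType dS)
  (kappa : R.-pker Omega ~> Omega) (f : {mfun Omega >-> R})
  (dV : measure_display) (V : measurableType dV)
  (Q : probability V R) (Z1 : {RV Q >-> R}) (S : set R).
Hypothesis S_up : forall s t : R, s <= t -> S s -> S t.
Hypothesis dom_out : forall x, S (f x) ->
  dominated_at kappa f Q x (fun v => f x + Z1 v).

(* State 0 means that the path has not met [K] yet. *)
Definition confined_step (j : nat) (x : Omega) : nat :=
  if f x \in S then j else 1%N.

Definition confined (j : nat) (x : Omega) : \bar R := ((j == 0%N)%:R)%:E.

Lemma measurable_confined_step j i : measurable [set x | confined_step j x = i].
Proof.
by apply: (measurable_if_nat (measurable_preimage_up f S_up)) => {}i;
  exact: measurable_set_cst.
Qed.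

Lemma confined_ge0 j x : (0 <= confined j x)%E.
Proof. by rewrite lee_fin. Qed.

Lemma measurable_confined j : measurable_fun setT (confined j).
Proof. exact: measurable_cst. Qed.

(** Reading [X 0] to [X n] takes [n.+1] letters, while [survival] at [n] tests the walk at times 0
    to [n]; hence the shift of index. *)
Lemma confined_value_le n x :
  (machine_value kappa confined_step confined n.+1 0 x <= survival Z1 S n (f x))%E.
Proof.
(* A nonzero state never returns to 0, and its reward is 0. *)
have out m j y : machine_value kappa confined_step confined m j.+1 y = 0%E.
  elim: m j y => [//|m IH] j y /=; apply: integral0_eq => z _.
  by rewrite /confined_step; case: ifP.
elim: n x => [|n IH] x.
  rewrite /survival /= /confined_step; case: (f x \in S).
    by rewrite integral_cst// mul1e prob_kernel.
  by rewrite integral0_eq.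
rewrite -[leLHS]/(\int[kappa x]_y machine_value kappa confined_step confined n.+1
  (confined_step 0 x) y)%E.
rewrite -[leRHS]/(if f x \in S then \int[Q]_v survival Z1 S n (f x + Z1 v)%R else 0)%E.
rewrite /confined_step; have [fS|fS] := boolP (f x \in S); last first.
  by rewrite integral0_eq// => y _; exact: (out n.+1).
have /set_mem Sfx := fS.
apply: (@le_trans _ _ (\int[kappa x]_y survival Z1 S n (f y))%E); last first.
  apply: (dom_out Sfx (C := 1)).
  - exact: survival_ge0.
  - exact: survival_le1.
  - exact: survival_homo.
apply: ge0_le_integral => //.
- by move=> y _; exact: (machine_value_ge0 kappa confined_step confined_ge0 n.+1).
- exact: (measurable_machine_value kappa measurable_confined_step confined_ge0
    measurable_confined n.+1).
- by apply: measurableT_comp => //; apply: homo_measurable; exact: survival_homo.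
Qed.

End confinement.

(** * The budget along a single path *)

Section budget_path.
Context (R : realType) (T : Type) (f : T -> R) (S : set R) (r : R) (q : nat)
  (y : nat -> T).
Hypothesis rS : forall x, r < f x -> S (f x).

Let budget := machine_run (fun c x =>
  if f x \in S then (if r < f x then (c - q)%N else c) else c.+1) y 0.

Let budgetS k : budget k.+1 = if f (y k) \in S then
  if r < f (y k) then (budget k - q)%N else budget k else (budget k).+1.
Proof. by []. Qed.

(** Once the truncation has stopped acting, the budget is an exact account: spending is at most the
    initial amount plus one unit per step. *)
Lemma budget_density :
  (exists n0, forall k, (n0 <= k)%N -> ~ (budget k = 0%N /\ f (y k) \notin S)) ->
  (forall n, exists2 k, (n <= k)%N & f (y k) \notin S) ->
  exists C, forall n, (q * \sum_(k < n) (r < f (y k))%R <= n + C)%N.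
Proof.
move=> [n0 solvent] back.
(* An empty budget stays empty until the next visit to [K]; [back] supplies that visit and [solvent]
   forbids it. *)
have pos k : (n0 <= k)%N -> (0 < budget k)%N.
  move=> n0k; rewrite lt0n; apply/eqP => bk.
  have [m km ym] := back k; move: km ym => /subnKC <-.
  move: (m - k)%N => d; elim: d k n0k bk => {m} [|d IH] k n0k bk.
    by rewrite addn0 => ym; exact: (solvent k).
  rewrite addnS -addSn; have [yk|yk _] := boolP (f (y k) \in S).
    apply: (IH k.+1); first exact: leqW.
    by rewrite budgetS yk bk sub0n; case: ifP.
  exact: (solvent k).
(* Up to [n0], each time is charged at most [q]; afterwards the spending is at most [budget n0] plus
   the elapsed time. *)
exists (q * n0 + budget n0)%N => n.
have step m : (q * \sum_(k < m) (r < f (y (n0 + k)%N))%R + budget (n0 + m) <=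
    budget n0 + m)%N.
  elim: m => [|m IH]; first by rewrite big_ord0 muln0 !addn0.
  rewrite big_ord_recr/= mulnDr addnS.
  (* Positivity of the next budget shows that the truncated subtraction is exact. *)
  have := pos (n0 + m).+1 (leqW (leq_addr _ _)); rewrite budgetS.
  case: (boolP (f (y (n0 + m)%N) \in S)) => yS; last first.
    have /negbTE -> : ~~ (r < f (y (n0 + m)%N)).
      by apply: contra yS => /rS/mem_set.
    by move=> _; rewrite muln0 addn0 !addnS ltnS.
  move: IH; set a := (q * _)%N; set b := budget (n0 + m).
  by case: (r < _); rewrite ?muln1 ?muln0; lia.
have [nn0|n0n] := leqP n n0.
  apply: (@leq_trans (q * n)); last by nia.
  rewrite leq_mul2l; apply/orP; right; rewrite -[leqRHS]card_ord -sum1_card.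
  by apply: leq_sum => k _; exact: leq_b1.
have h := step (n - n0)%N.
rewrite -(big_mkord xpredT (fun k => nat_of_bool (r < f (y k))%R)).
rewrite (big_cat_nat (n := n0))//=; last exact: ltnW.
have h1 : (\sum_(0 <= k < n0) (r < f (y k))%R <= n0)%N.
  rewrite -[leqRHS]subn0 -[leqRHS]muln1 -sum_nat_const_nat.
  by apply: leq_sum => k _; exact: leq_b1.
have h2 : (\sum_(n0 <= k < n) (r < f (y k))%R =
    \sum_(k < n - n0) (r < f (y (n0 + k)%N))%R)%N.
  rewrite -{1}(add0n n0) big_addn big_mkord.
  by apply: eq_bigr => k _; rewrite addnC.
rewrite h2 mulnDr.
move: h h1; set a := (\sum_(k < n - n0) _)%N; set b := (\sum_(0 <= k < n0) _)%N.
move=> h h1; have : (q * b <= q * n0)%N by rewrite leq_mul2l h1 orbT.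
lia.
Qed.

End budget_path.

Lemma limn_esup_le_near (R : realType) (u : nat -> \bar R) (l : \bar R) (n0 : nat) :
  (forall n, (n0 <= n)%N -> (u n <= l)%E) -> (limn_esup u <= l)%E.
Proof.
move=> h; apply: ge_ereal_inf; exists (ereal_sup (u @` [set n | (n0 <= n)%N])).
  by exists [set n | (n0 <= n)%N] => //; exists n0.
by apply: ge_ereal_sup => _ [n /= nn <-]; exact: h.
Qed.

(** * Chains with dominated drift *)

Lemma almost_sure_ge (R : realType) (dV : measure_display) (V : measurableType dV)
    (Q : probability V R) (Z : {RV Q >-> R}) (m : R) :
  (forall t, t < m -> Q [set v | t < Z v] = 1%E) -> {ae Q, forall v, m <= Z v}.
Proof.
move=> h; have hc := closed_tail_cvg (P := Q) (Y := Z) (m := m).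
have Q1 : Q [set v | m <= Z v] = 1%E.
  rewrite -(cvg_lim _ hc)//; apply: lim_near_cst => //.
  by apply: nearW => n; rewrite h// ltrBlDr ltrDl invr_gt0.
have mle : measurable [set v | m <= Z v].
  rewrite (_ : [set v | _] = Z @^-1` `[m, +oo[); last first.
    by apply/seteqP; split => w /=; rewrite in_itv/= andbT.
  by rewrite -[X in measurable X]setTI; exact: measurable_funP.
exists (~` [set v | m <= Z v]); split => //; first exact: measurableC.
by rewrite probability_setC// Q1 subee.
Qed.

(** Almost surely the positive part is [s + Z] itself, so its mean is linear. *)
Lemma integral_positive_part (R : realType) (dV : measure_display)
    (V : measurableType dV) (Q : probability V R) (Z : {RV Q >-> R}) (s lambda1 : R) :
  Q.-integrable setT (EFin \o Z) -> ('E_Q[Z] = (- lambda1)%:E)%E ->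
  {ae Q, forall v, - s <= Z v} ->
  (\int[Q]_v (Num.max (s + Z v) 0)%:E = (s - lambda1)%:E)%E.
Proof.
move=> Zi ZE Zs.
have mZ : measurable_fun setT (fun v => s + Z v) by exact: measurable_funD.
transitivity (\int[Q]_v (s%:E + (Z v)%:E))%E.
  apply: ae_eq_integral => //.
  - by apply/measurable_EFinP; exact: measurable_maxr.
  - exact/measurable_EFinP.
  - apply: filterS Zs => v sZ _; rewrite -EFinD; congr EFin; apply/max_idPl.
    by rewrite addrC -lerBlDr sub0r.
rewrite integralD//; last exact: finite_measure_integrable_cst.
rewrite integral_cst// [X in (_ * X)%E](probability_setT Q) mule1 EFinD -ZE.
congr (_ + _)%E.
by rewrite unlock.
Qed.

Section dominated_drift.
Context (R : realType) (dS : measure_display) (Omega : measurableType dS)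
  (f : {mfun Omega >-> R}) (dW : measure_display) (W : measurableType dW)
  (kappa : R.-pker Omega ~> Omega) (P : Omega -> probability W R)
  (X : nat -> {mfun W >-> Omega}) (X_markov : is_markov_chain kappa P X)
  (dV : measure_display) (V : measurableType dV) (Q : probability V R).

Lemma tail_dominated_at (x : Omega) (Z : {RV Q >-> R}) :
  (forall t : R,
    P x [set w | (t < f (X 1%N w) - f x)%R] <= Q [set v | (t < Z v)%R])%E ->
  dominated_at kappa f Q x (fun v => f x + Z v).
Proof.
move=> tail h C h0 hC hm.
have mh : measurable_fun setT (fun y => h (f y)).
  by apply: measurableT_comp => //; exact: homo_measurable.
rewrite (kernel_lawE X_markov)//.
have m1 : measurable_fun setT (fun w => f (X 1%N w)) by exact: measurableT_comp.
have m2 : measurable_fun setT (fun v => f x + Z v) by exact: measurable_funD.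
pose Y1 : {mfun W >-> R} := HB.pack (fun w => f (X 1%N w))
  (isMeasurableFun.Build _ _ _ _ _ m1).
pose Y2 : {mfun V >-> R} := HB.pack (fun v => f x + Z v)
  (isMeasurableFun.Build _ _ _ _ _ m2).
apply: (le_integral_stoch_dom (P1 := P x) (P2 := Q) (Y1 := Y1) (Y2 := Y2)
  (h := h) (C := C)) => // t.
have := tail (t - f x); congr (P x _ <= Q _)%E.
  by apply/seteqP; split => w /=; rewrite ltrD2r.
by apply/seteqP; split => v /=; rewrite ltrBlDl.
Qed.

Context (Z0 Z1 : {RV Q >-> R}) (f_ge0 : forall x : Omega, 0 <= f x)
  (Z0_int : Q.-integrable setT (EFin \o Z0))
  (Z1_int : Q.-integrable setT (EFin \o Z1))
  (lambda1 : R) (lambda1_gt0 : 0 < lambda1)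
  (Z1_mean : ('E_Q[Z1] = (- lambda1)%:E)%E) (R0 : R).
Hypothesis tail_in : forall (x : Omega) (t : R), f x <= R0 ->
  (P x [set w | (t < f (X 1%N w) - f x)%R] <= Q [set v | (t < Z0 v)%R])%E.
Hypothesis tail_out : forall (x : Omega) (t : R), R0 < f x ->
  (P x [set w | (t < f (X 1%N w) - f x)%R] <= Q [set v | (t < Z1 v)%R])%E.

(** The ray []R0, +oo[] could be too large: one of its points lying below all values of [f] outside
    [K] need not stay nonnegative after a jump [Z1]. *)
Definition outer : set R := [set s | exists2 x, R0 < f x & f x <= s].

Lemma outer_up s t : s <= t -> outer s -> outer t.
Proof. by move=> st [x R0x xs]; exists x => //; exact: le_trans st. Qed.

Lemma outerE x : outer (f x) <-> R0 < f x.
Proof. by split => [[y R0y yx]|R0x]; [exact: lt_le_trans yx|exists x]. Qed.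

Lemma outer_ge0 s : outer s -> 0 <= s.
Proof. by move=> [x _]; exact: le_trans. Qed.

Lemma dominated_out x : outer (f x) -> dominated_at kappa f Q x (fun v => f x + Z1 v).
Proof. by move=> /outerE R0x; apply: tail_dominated_at => t; exact: tail_out. Qed.

(** On [K], [f x <= R0], and a nondecreasing test function allows the start to be raised to [R0];
    the bound becomes uniform over [K]. *)
Lemma dominated_in x : ~ outer (f x) -> dominated_at kappa f Q x (fun v => R0 + Z0 v).
Proof.
move=> /outerE/negP; rewrite -leNgt => fxR0 h C h0 hC hm.
apply: (@le_trans _ _ (\int[Q]_v h (f x + Z0 v)%R)%E).
  by apply: tail_dominated_at hC _ => // t; exact: tail_in.
apply: ge0_le_integral => //.
- exact: measurable_translate.
- exact: measurable_translate.
- by move=> v _; apply: hm; rewrite lerD2r.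
Qed.

(** Since [f] is nonnegative, a jump from [x] exceeds every [t < - f x] surely. Domination transfers
    this to [Z1], so [Z1 >= - f x >= - s] almost surely. *)
Lemma outer_drift s : outer s ->
  (\int[Q]_v (Num.max (s + Z1 v) 0)%:E <= (s - lambda1)%:E)%E.
Proof.
move=> [x R0x xs]; rewrite (integral_positive_part Z1_int Z1_mean)//.
have := @almost_sure_ge _ _ _ Q Z1 (- f x) _.
move=> H; apply: filterS (H _) => [v|t tx].
  by apply: le_trans; rewrite lerN2.
apply/eqP; rewrite eq_le probability_le1/=; last exact: measurable_gt.
apply: le_trans (tail_out t R0x).
rewrite (_ : [set w | _] = setT) ?probability_setT//.
apply/seteqP; split => // w _ /=.
by rewrite ltrBrDr (lt_le_trans _ (f_ge0 _))// -ltrBrDr sub0r.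
Qed.

Lemma survival_cost n s :
  (lambda1%:E * \sum_(k < n) survival Z1 outer k s <= (Num.max s 0)%:E)%E.
Proof.
by apply: sum_survival_le => //; [exact: outer_up|exact: outer_ge0|exact: outer_drift].
Qed.

(** Combines [n * survival n <= sum] with the bound of the sum by [s / lambda1]. *)
Lemma survival_decay n s : (0 < n)%N -> 0 <= s ->
  (survival Z1 outer n s <= (s / (n%:R * lambda1))%:E)%E.
Proof.
move=> n0 s0; have := survival_cost n s; rewrite (max_idPl s0).
have ge0 := survival_ge0 Z1 outer n s.
have le1 := survival_le1 Z1 outer_up n s.
have := survival_sum Z1 outer_up n s.
have fin : survival Z1 outer n s \is a fin_num.
  by rewrite ge0_fin_numE// (le_lt_trans le1)// ltry.
move: ge0; rewrite -(fineK fin); set u := fine _ => _ hsum hcost.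
have := le_trans (lee_wpmul2l (ltW (lambda1_gt0 : (0 < lambda1%:E)%E)) hsum) hcost.
rewrite -!EFinM !lee_fin => h.
rewrite ler_pdivlMr ?mulr_gt0 ?ltr0n//.
by have -> : u * (n%:R * lambda1) = lambda1 * (n%:R * u) by ring.
Qed.

Lemma survival_cvg0 s : 0 <= s -> survival Z1 outer n s @[n --> \oo] --> 0%E.
Proof.
move=> s0.
have h : survival Z1 outer n.+1 s @[n --> \oo] --> 0%E.
  apply: (squeeze_cvge (f := cst 0%E)
      (h := fun m => (s / lambda1 * m.+1%:R^-1)%:E)).
  - apply: nearW => m; rewrite survival_ge0/=; apply: le_trans (survival_decay _ s0) _ => //.
    by rewrite lee_fin invfM mulrA mulrAC.
  - exact: cvg_cst.
  - apply: cvg_EFin; first exact: nearW.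
    by rewrite -[X in _ --> X](mulr0 (s / lambda1)); apply: cvgMr; exact: cvg_harmonic.
by rewrite -(cvg_shiftS (fun n => survival Z1 outer n s)).
Qed.

(** Integrability of [Z0] makes the mean positive part of [R0 + Z0] finite; divided by [lambda1], it
    bounds the expected length of an excursion. *)
Lemma return_cost_bounded : exists C : R, forall n,
  (\int[Q]_v \sum_(k < n) survival Z1 outer k (R0 + Z0 v)%R <= C%:E)%E.
Proof.
have mZ : measurable_fun setT (fun v => R0 + Z0 v) by exact: measurable_funD.
set M := (\int[Q]_v (Num.max (R0 + Z0 v) 0)%:E)%E.
have M0 : (0 <= M)%E.
  by apply: integral_ge0 => v _; rewrite lee_fin le_max lexx orbT.
have Mfin : M \is a fin_num.
  rewrite ge0_fin_numE//.
  have /integrableP[_] : Q.-integrable setT (fun v => (R0%:E + (Z0 v)%:E)%E).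
    by apply: integrableD => //; exact: finite_measure_integrable_cst.
  apply: le_lt_trans; apply: ge0_le_integral => //.
  - by move=> v _; rewrite lee_fin le_max lexx orbT.
  - by apply/measurable_EFinP; exact: measurable_maxr.
  - by apply: measurableT_comp => //; exact/measurable_EFinP.
  - by move=> v _; rewrite -EFinD /= lee_fin ge_max normr_ge0 ler_norm.
exists (fine M / lambda1) => n.
have mW := measurable_sum_survival Z1 outer_up Z0 n R0.
have W0 v := sum_survival_ge0 Z1 outer n (R0 + Z0 v).
rewrite mulrC EFinM fineK// lee_pdivlMl// -ge0_integralZl//; last by rewrite lee_fin ltW.
apply: ge0_le_integral => //.
- by move=> v _; rewrite mule_ge0 ?W0 ?lee_fin ?ltW.
- exact: measurable_funeM.
- by apply/measurable_EFinP; exact: measurable_maxr.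
- by move=> v _; exact: survival_cost.
Qed.

Lemma start_machine_value (st : nat -> Omega -> nat) (h : nat -> Omega -> \bar R) x n j :
  (forall j i, measurable [set x | st j x = i]) -> (forall j x, 0 <= h j x)%E ->
  (forall j, measurable_fun setT (h j)) ->
  (\int[P x]_w h (machine_run st (fun m => X m w) j n) (X n w) =
   machine_value kappa st h n j x)%E.
Proof.
move=> mst h0 mh; have hT := @process_historyT _ _ _ _ X 0%N.
rewrite (machine_integral X_markov mst h0 mh x j n hT).
rewrite (markov_initial X_markov)//; first by move=> y; exact: machine_value_ge0.
exact: measurable_machine_value.
Qed.

Let mfX n : measurable_fun setT (fun w => f (X n w)).
Proof. exact: measurableT_comp. Qed.

Let fX n : {mfun W >-> R} := HB.pack (fun w => f (X n w))
  (isMeasurableFun.Build _ _ _ _ _ (mfX n)).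

(** The event [B] of avoiding [K] from time [n] on has probability at most the mean of [survival m]
    at [f (X n)], for every [m]; this mean tends to 0 by dominated convergence. *)
Lemma recurrent x : {ae P x, forall w, forall n,
  exists2 k, (n <= k)%N & f (X k w) \notin outer}.
Proof.
apply: ae_foralln => n.
pose B := \bigcap_k [set w | f (X (n + k)%N w) \in outer].
have mB : measurable B.
  apply: bigcap_measurable => // k _.
  exact: (measurable_preimage_up (fX (n + k)) outer_up).
exists B; split => //; last first.
  move=> w /= nw k _ /=; apply: contrapT => /negP wk; apply: nw.
  by exists (n + k)%N => //; exact: leq_addr.
have mst := measurable_confined_step f outer_up.
have stay w : B w -> forall m,
    machine_run (confined_step f outer) (fun i => X (n + i)%N w) 0 m = 0%N.
  by move=> Bw; elim=> //= m ->; rewrite /confined_step (Bw m I).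
have surv0 m s := survival_ge0 Z1 outer m s.
have msurv m : measurable_fun setT (fun w => survival Z1 outer m (f (X n w))).
  apply: (measurableT_comp (f := survival Z1 outer m)) => //.
  by apply: homo_measurable; exact: (survival_homo Z1 outer_up m).
have surv m : (P x B <= \int[P x]_w survival Z1 outer m (f (X n w)))%E.
  apply: (@le_trans _ _ (\int[P x]_w machine_value kappa
      (confined_step f outer) (@confined R _ Omega) m.+1 0 (X n w))%E); last first.
    apply: ge0_le_integral => //.
    - by move=> w _; exact: (machine_value_ge0 kappa _ (@confined_ge0 R _ Omega)).
    - exact: (measurableT_comp (measurable_machine_value kappa mst
        (@confined_ge0 R _ Omega) (@measurable_confined R _ Omega) m.+1 0)).
    - by move=> w _; exact: (confined_value_le outer_up dominated_out).
  rewrite -(machine_integral X_markov mst (@confined_ge0 R _ Omega)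
    (@measurable_confined R _ Omega) x 0 m.+1 (@process_historyT _ _ _ _ X n)).
  rewrite (_ : P x B = \int[P x]_w (\1_B w)%:E)%E; last by rewrite integral_indic// setIT.
  apply: ge0_le_integral => //.
  - exact/measurable_EFinP.
  - exact: (measurable_machine_reward X mst (@measurable_confined R _ Omega) n 0 m.+1).
  - move=> w _; rewrite indicE; have [/set_mem Bw|_] := boolP (w \in B).
      by rewrite (stay w Bw m.+1).
    by rewrite lee_fin.
have cvg0 : (\int[P x]_w survival Z1 outer m (f (X n w)))%E @[m --> \oo] --> 0%E.
  have [] := @dominated_convergence _ _ _ (P x) _ measurableT
    (fun m w => survival Z1 outer m (f (X n w))) (cst 0%E) (cst 1%E).
  - exact: msurv.
  - by [].
  - by apply: aeW => w _; exact: survival_cvg0.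
  - exact: finite_measure_integrable_cst.
  - apply: aeW => w m _; rewrite gee0_abs//; exact: (survival_le1 Z1 outer_up).
  - by move=> _ _; rewrite integral0.
apply/eqP; rewrite eq_le measure_ge0 andbT -(cvg_lim _ cvg0)//.
apply: lime_ge; first by apply/cvg_ex; eexists; exact: cvg0.
exact: nearW.
Qed.

Section level.
Context (r : R) (outer_above : forall x, r < f x -> outer (f x)).

Let wcost k := (\int[Q]_v killed_walk Z1 outer (above r) k (R0 + Z0 v)%R)%E.

(** The walk from [f x] is above [r] only if it survives, which gives the decaying term; excursions
    begun in [K] contribute at most [delta]. *)
Lemma tail_bound (delta : R) x n : (0 < n)%N ->
  (forall m, \sum_(k < m) wcost k <= delta%:E)%E ->
  (P x [set w | (r < f (X n w))%R] <= (delta + f x / (n%:R * lambda1))%:E)%E.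
Proof.
move=> n0 small.
have a0 := @above_ge0 R r; have ah := @above_homo R r.
(* An automaton that never changes state turns the machine value into a plain expectation. *)
have -> : P x [set w | (r < f (X n w))%R] =
    machine_value kappa (fun j _ => j) (fun _ y => above r (f y)) n 0 x.
  rewrite -start_machine_value//.
  - rewrite -[in LHS](setIT [set w | _]) -integral_indic//; last first.
      exact: (measurable_gt (fX n)).
    apply: eq_integral => w _; rewrite /above indicE; congr (_%:R%:E); congr nat_of_bool.
    by apply/idP/idP => [/set_mem//|rf]; rewrite inE.
  - by move=> j i; exact: measurable_set_cst.
  - by move=> j; apply: measurableT_comp => //; exact: homo_measurable.
apply: le_trans (tail_prob_le outer_up dominated_out dominated_in outer_above n x) _.
rewrite addeC EFinD leeD//.
apply: le_trans (survival_decay n0 (f_ge0 x)).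
by apply: killed_walk_le => //; [exact: outer_up|exact: above_le1].
Qed.

(** Borel-Cantelli: the expected number of visits to [K] with an empty budget is at most 2. *)
Lemma finitely_broke (q : nat) x : (0 < q)%N ->
  (forall m, \sum_(k < m) wcost k <= (2 * q%:R)^-1%:E)%E ->
  {ae P x, forall w, exists n0, forall k, (n0 <= k)%N ->
    ~ (machine_run (budget_step f outer r q) (fun i => X i w) 0 k = 0%N /\
       f (X k w) \notin outer)}.
Proof.
move=> q0 small.
pose E k := [set w | machine_run (budget_step f outer r q) (fun i => X i w) 0 k = 0%N] `&`
  [set w | f (X k w) \notin outer].
have mst := measurable_budget_step f outer_up r q.
have mE k : measurable (E k).
  apply: measurableI; first exact: (measurable_machine_run X mst 0).
  rewrite (_ : [set w | _] = ~` [set w | f (X k w) \in outer]); last first.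
    by apply/seteqP; split => w /= /negP.
  by apply: measurableC; exact: (measurable_preimage_up (fX k) outer_up).
have PE k : P x (E k) = machine_value kappa (budget_step f outer r q)
    (broke f outer) k 0 x.
  rewrite -start_machine_value//; last 2 first.
  - by move=> j y; exact: broke_ge0.
  - by move=> j; exact: (measurable_broke f outer_up j).
  rewrite -[in LHS](setIT (E k)) -integral_indic//; apply: eq_integral => w _.
  rewrite indicE /broke; congr (_%:R%:E); congr nat_of_bool.
  apply/idP/idP => [/set_mem[/= -> -> //]|/andP[/eqP r0 fS]].
  by rewrite inE.
have PE0 : P x (lim_sup_set E) = 0%E.
  apply: lim_sup_set_cvg0 => //.
  apply: (@le_lt_trans _ _ 2%:E); last exact: ltry.
  apply: lime_le; first exact: is_cvg_nneseries.
  apply: nearW => n; rewrite big_mkord (eq_bigr _ (fun (k : 'I_n) _ => PE k)).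
  (* Each partial sum takes its own length as the horizon [N]. *)
  exact: (broke_count_le2 outer_up dominated_out dominated_in 0 x small q0
    (leqnn n)).
exists (lim_sup_set E); split => //.
  by apply: bigcap_measurable => // n _; apply: bigcup_measurable => k _; exact: mE.
move=> w /= nw n _ /=; apply: contrapT => nk; apply: nw; exists n => k nk' [k0 kS].
by apply: nk; exists k.
Qed.

End level.
End dominated_drift.

(** * Choice of the level and conclusion *)

Unset Implicit Arguments.
Set Strict Implicit.

Theorem theoremD (R : realType)
    (dS : measure_display) (Omega : measurableType dS)
    (f : {mfun Omega >-> R}) (f_ge0 : forall x : Omega, 0 <= f x)
    (dW : measure_display) (W : measurableType dW)
    (kappa : R.-pker Omega ~> Omega)
    (P : Omega -> probability W R) (X : nat -> {mfun W >-> Omega})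
    (X_markov : is_markov_chain kappa P X)
    (dZ : measure_display) (V : measurableType dZ) (Q : probability V R)
    (Z0 Z1 : {RV Q >-> R})
    (Z0_int : Q.-integrable setT (EFin \o Z0))
    (Z1_int : Q.-integrable setT (EFin \o Z1))
    (lambda1 : R) (lambda1_gt0 : 0 < lambda1)
    (Z1_mean : ('E_Q[Z1] = (- lambda1)%:E)%E)
    (R0 : R) (K : set Omega) (K_def : K = [set x | f x <= R0])
    (tail_in : forall (x : Omega) (t : R), K x ->
       (P x [set w | (t < f (X 1%N w) - f x)%R] <= Q [set v | (t < Z0 v)%R])%E)
    (tail_out : forall (x : Omega) (t : R), ~ K x ->
       (P x [set w | (t < f (X 1%N w) - f x)%R] <= Q [set v | (t < Z1 v)%R])%E) :
  forall eps : R, 0 < eps -> exists2 r : R, 0 < r & forall x : Omega,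
    (forall n : nat, (1 <= n)%N ->
       (P x [set w | (r < f (X n w))%R] < (eps + f x / (n%:R * lambda1))%:E)%E) /\
    {ae P x, forall w : W,
       (limn_esup (fun n : nat =>
          ((n%:R)^-1 * #|[pred k : 'I_n.+1 | (1 <= k)%N && (r < f (X k w))%R]|%:R)%:E)
        < eps%:E)%E}.
Proof.
have in_tail x t (fx : f x <= R0) := tail_in x t (eq_ind_r (fun A => A x) fx K_def).
have out_tail x t : R0 < f x ->
    (P x [set w | (t < f (X 1%N w) - f x)%R] <= Q [set v | (t < Z1 v)%R])%E.
  by move=> fx; apply: tail_out; rewrite K_def /=; apply/negP; rewrite -ltNge.
move=> eps eps0.
(* The factor 2 absorbs the additive constant of [budget_density], through [n + O(1) <= 2 * n]. *)
pose q := (Num.truncn (2 / eps)).+1.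
have q_gt0 : (0 : R) < q%:R by rewrite ltr0n.
have qeps : 2 / q%:R < eps.
  by rewrite ltr_pdivrMr// mulrC -ltr_pdivrMr// truncnS_gt.
(* The first bound gives the strict inequality in (i), the second is the smallness required in
   (ii). *)
pose delta := Num.min (eps / 2) (2 * q%:R)^-1.
have delta0 : 0 < delta by rewrite lt_min divr_gt0//= invr_gt0 mulr_gt0.
have [C hC] := return_cost_bounded f_ge0 Z0_int Z1_int lambda1_gt0 Z1_mean out_tail.
have small := sum_killed_walk_above_small (outer_up (f := f) (R0 := R0)) delta0 hC.
(* The level is also taken above [R0], so that points above it lie outside [K]. *)
have [i _ iP] := filterI small (nbhs_infty_ge (Num.truncn R0).+1).
have {iP} [small_i R0i] := iP i (leqnn i).
have i_gt0 : (0 < i)%N by exact: leq_ltn_trans R0i.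
have level x : i%:R < f x -> outer f R0 (f x).
  move=> ifx; apply/outerE; apply: lt_trans ifx; apply: lt_le_trans (truncnS_gt R0) _.
  by rewrite ler_nat.
exists i%:R => [|x]; first by rewrite ltr0n.
split=> [n n0|].
  apply: le_lt_trans (tail_bound X_markov f_ge0 Z1_int lambda1_gt0 Z1_mean
    in_tail out_tail level x n0 small_i) _.
  rewrite lte_fin ltrD2r (@le_lt_trans _ _ (eps / 2))// ?ge_min ?lexx//.
  by rewrite ltr_pdivrMr// ltr_pMr// ltr1n.
have small_q m : (\sum_(k < m) \int[Q]_v killed_walk Z1 (outer f R0) (above i%:R) k
    (R0 + Z0 v)%R <= (2 * q%:R)^-1%:E)%E.
  by apply: le_trans (small_i m) _; rewrite lee_fin ge_min lexx orbT.
have back_ae := recurrent X_markov f_ge0 Z1_int lambda1_gt0 Z1_mean out_tail x.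
have solvent_ae :=
  finitely_broke X_markov in_tail out_tail x (ltn0Sn (Num.truncn (2 / eps))) small_q.
apply: filterS2 back_ae solvent_ae => w back solvent.
have [D hD] := budget_density level solvent back.
apply: (@le_lt_trans _ _ (2 / q%:R)%:E); last by rewrite lte_fin.
(* For [n > D], [n + 1 + D <= 2 * n]. *)
apply: (limn_esup_le_near (n0 := D.+1)) => n Dn.
set N := #|_|.
(* The bound for the [n.+1] times from 0 to [n] also counts time 0, which can only enlarge the
   sum. *)
have N_le : (q * N <= n.+1 + D)%N.
  apply: leq_trans (hD n.+1); rewrite leq_mul2l; apply/orP; right.
  rewrite /N -sum1_card big_mkcond/=; apply: leq_sum => k _.
  by rewrite inE; case: (1 <= k)%N => //=; case: (_ < _).
have n_gt0 : (0 : R) < n%:R by rewrite ltr0n (leq_ltn_trans _ Dn).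
rewrite lee_fin mulrC ler_pdivrMr// mulrAC ler_pdivlMr// -!natrM ler_nat mulnC.
by apply: leq_trans N_le _; lia.
Qed.
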